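(* Let $G$ be a ($T_1$) sequential topological group with countable $\mathrm{cs}^*$-character. Then $G$ is metrizable if at least one of the following conditions is satisfied: (1) $\mathrm{so}(G)<\omega_1$; (2) $\mathrm{sb}_\chi(G)<\mathfrak d$; (3) $ib(G)<k(G)$; (4) $G$ is Fréchet–Urysohn; (5) $G$ is an $\alpha_7$-space; (6) $G$ contains no closed copy of $S_\omega$ or $S_2$ (i.e. no closed subspace of $G$ is homeomorphic to $S_\omega$ or to $S_2$); (7) $G$ is not Weil complete; (8) $G$ is Baire; (9) $ib(G)<|G|<2^{\aleph_0}$.
   Context: All topological spaces (and groups) are assumed to be $T_1$. A space $X$ is sequential if a subset $A\subset X$ is closed whenever it contains the limits of all sequences of points of $A$ that converge in $X$. $X$ is Fréchet–Urysohn if whenever $a\in X$ is a cluster point of $A\subset X$ there is a sequence in $A$ convergent to $a$. A family $\mathcal N$ of subsets of $X$ is a $\mathrm{cs}^*$-network at $x\in X$ if for every neighborhood $U$ of $x$ and every sequence $(x_n)\subset X$ convergent to $x$ there is $N\in\mathcal N$ with $N\subset U$ such that $x_n\in N$ for infinitely many $n$. $\mathrm{cs}^*_\chi(X)=\sup_{x\in X}\mathrm{cs}^*_\chi(X,x)$, where $\mathrm{cs}^*_\chi(X,x)$ is the smallest size of a $\mathrm{cs}^*$-network at $x$; $X$ has countable $\mathrm{cs}^*$-character if $\mathrm{cs}^*_\chi(X)\le\aleph_0$. A set $B\subset X$ is a sequential barrier at $x$ if every sequence in $X$ convergent to $x$ has all but finitely many terms in $B$. An $\mathrm{sb}$-network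 at $x$ is a family $\mathcal N$ of sequential barriers at $x$ such that for every neighborhood $U$ of $x$ there is $N\in\mathcal N$ with $x\in N\subset U$. $\mathrm{sb}_\chi(X)$ is the supremum over $x\in X$ of the smallest size of an $\mathrm{sb}$-network at $x$. $\mathfrak d$ is the cofinality of $\mathbb N^\omega$ with the coordinatewise order. For $A\subset X$ let $A^{(1)}$ be the set of limits of sequences of points of $A$ convergent in $X$, and $A^{(\alpha)}=\bigcup_{1\le\beta<\alpha}(A^{(\beta)})^{(1)}$ for ordinals $\alpha\ge2$; $\mathrm{so}(X)$ is the smallest ordinal $\alpha\ge1$ such that $A^{(\alpha+1)}=A^{(\alpha)}$ for every $A\subset X$. $ib(G)$ is the smallest cardinal $\kappa$ such that for each non-empty open $U\subset G$ there is $F\subset G$ with $|F|\le\kappa$ and $G=F\cdot U$. A space $X$ carries the inductive topology with respect to a cover $\mathcal C$ if $F\subset X$ is closed if and only if $F\cap C$ is closed in $C$ for each $C\in\mathcal C$. A $k$-space is a space carrying the inductive topology with respect to the cover by all its compact subsets (every sequential space is a $k$-space); its $k$-ness $k(X)$ is the smallest size of a cover $\mathcal K$ of $X$ by compact subsets such that $X$ carries the inductive topology with respect to $\mathcal K$. A sequence converging to $x$ is here understood as a countable infinite subset $S\subset X$ such that $S\setminus U$ is finite for each neighborhood $U$ of $x$. $X$ is an $\alpha_7$-space if for any sequences $S_n\subset X$, $n\in\omega$, convergent to a point $x\in X$ there is a sequence $S\subset X$ convergent to some point $y\in X$ such that $S_n\cap S\neq\emptyset$ for infinitely many $n$. The Arens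 space $S_2$ is the set $\{(0,0),(\frac1n,0),(\frac1n,\frac1{nm}):n,m\in\mathbb N\}\subset\mathbb R^2$ with the strongest topology inducing the planar topology on the convergent sequences $C_0=\{(0,0),(\frac1n,0):n\in\mathbb N\}$ and $C_n=\{(\frac1n,0),(\frac1n,\frac1{nm}):m\in\mathbb N\}$, $n\in\mathbb N$. The sequential fan $S_\omega=S_2/C_0$ is the quotient space obtained by collapsing $C_0$ to a point. A topological group is Weil complete if it is complete in its left (equivalently, right) uniformity. *)

(* Defs.v *)
From HB Require Import structures.
From mathcomp Require Import all_boot all_order all_algebra generic_quotient.
From mathcomp Require Import all_classical all_reals all_analysis.
Set Implicit Arguments.
Unset Strict Implicit.
Unset Printing Implicit Defensive.
Import Order.TTheory GRing.Theory Num.Theory.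
Import numFieldTopology.Exports.
Local Open Scope classical_set_scope.
Local Open Scope card_scope.

HB.mixin Record isTopologicalGroup G & Topological G & Group G := {
  mulg_continuous : continuous (fun x : G * G => (x.1 * x.2)%g) ;
  invg_continuous : continuous (fun x : G => (x^-1)%g)
}.

#[short(type="topologicalGroupType")]
HB.structure Definition TopologicalGroup :=
  {G of Topological G & Group G & isTopologicalGroup G}.

(** The left uniformity of [G], carried by an alias of [G]; its entourages are
    the sets containing some [{(x, y) | x^-1 y \in U}], [U] a neighborhood of
    [1]. *)
Definition left_uniform (G : Type) : Type := G.

Section LeftUniformity.
Variable G : topologicalGroupType.
Local Open Scope relation_scope.

Definition left_ent (U : set G) : set (G * G) :=
  [set p | U ((p.1)^-1 * p.2)%g].

Definition left_entourage : set_system (G * G) :=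
  filter_from (nbhs (1%g : G)) left_ent.

Let left_entourage_filter : Filter left_entourage.
Proof.
apply: filter_from_filter; first by exists setT; exact: filterT.
by move=> U V nU nV; exists (U `&` V) => //; exact: filterI.
Qed.

Let left_entourage_diagonal A : left_entourage A -> diagonal `<=` A.
Proof.
move=> [U nU UA] [x y] xy; apply: UA; have {xy} <- : x = y by [].
by rewrite /left_ent /= mulVg; exact: nbhs_singleton.
Qed.

Let left_entourage_inv A : left_entourage A -> left_entourage A^-1.
Proof.
move=> [U nU UA]; exists [set x | U (x^-1)%g].
  by apply: invg_continuous; rewrite invg1.
by move=> [x y] /=; rewrite /left_ent /= invgM invgK => Uxy; apply: UA.
Qed.

Let left_entourage_split A :
  left_entourage A -> exists2 B, left_entourage B & B \; B `<=` A.
Proof.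
move=> [U nU UA].
have : nbhs ((1, 1)%g : G * G) ((fun x : G * G => (x.1 * x.2)%g) @^-1` U).
  by apply: mulg_continuous; rewrite /= mulg1.
move=> [[V W] /= [nV nW] VWU]; exists (left_ent (V `&` W)).
  by exists (V `&` W) => //; exact: filterI.
move=> [x y] /= [z [Vxz _] [_ Wzy]]; apply: UA; rewrite /left_ent /=.
have := VWU ((x^-1 * z)%g, (z^-1 * y)%g) (conj Vxz Wzy).
by rewrite /= mulgA mulgK.
Qed.

Let left_nbhsE : (@nbhs G G) = nbhs_ left_entourage.
Proof.
apply/funext => x; apply/seteqP; split => A.
  move=> nA; exists (left_ent [set y | A (x * y)%g]).
    exists [set y | A (x * y)%g] => //.
    have cx : {for 1%g, continuous (fun y : G => (x * y)%g)}.
      apply: (@continuous_comp _ _ _ (fun y : G => (x, y))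
        (fun p : G * G => (p.1 * p.2)%g)); last exact: mulg_continuous.
      by apply: cvg_pair => /=; [exact: cvg_cst|exact: cvg_id].
    by apply: cx; rewrite mulg1.
  by move=> y /xsectionP; rewrite /left_ent /= mulVKg.
move=> [E [U nU UE] EA].
have cx : {for x, continuous (fun y : G => (x^-1 * y)%g)}.
  apply: (@continuous_comp _ _ _ (fun y : G => (x^-1, y)%g)
    (fun p : G * G => (p.1 * p.2)%g)); last exact: mulg_continuous.
  by apply: cvg_pair => /=; [exact: cvg_cst|exact: cvg_id].
have : nbhs x [set y | U (x^-1 * y)%g] by apply: cx; rewrite mulVg.
by apply: filterS => y Uxy; apply/EA/xsectionP/UE.
Qed.

HB.instance Definition _ := Topological.copy (left_uniform G) G.
HB.instance Definition _ := @Nbhs_isUniform_mixin.Build (left_uniform G)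
  left_entourage left_entourage_filter left_entourage_diagonal
  left_entourage_inv left_entourage_split left_nbhsE.

End LeftUniformity.

Definition weil_complete (G : topologicalGroupType) :=
  forall F : set_system (left_uniform G), ProperFilter F -> cauchy F ->
    exists x : left_uniform G, F --> x.

(** A cardinal is represented by a type of that cardinality, and a cardinal
    invariant by the predicate "[K] is of that cardinality". *)

Definition card_lt T U (A : set T) (B : set U) := A #<= B /\ ~ (B #<= A).

Definition least_cardinal (P : Type -> Prop) (K : Type) :=
  P K /\ forall L : Type, P L -> [set: K] #<= [set: L].

Definition least_size T (P : set T -> Prop) : Type -> Prop :=
  least_cardinal (fun K => exists2 A, P A & A #= [set: K]).

Definition sup_cardinal I (P : I -> Type -> Prop) : Type -> Prop :=
  least_cardinal (fun K => forall i L, P i L -> [set: L] #<= [set: K]).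

Definition invariant_lt (P Q : Type -> Prop) :=
  exists K L : Type, [/\ P K, Q L & card_lt [set: K] [set: L]].

(** The cofinality of the functions [nat -> nat] ordered coordinatewise. *)
Definition dominating_number : Type -> Prop :=
  least_size (fun D : set (nat -> nat) =>
    forall f, exists2 g, D g & forall n, (f n <= g n)%N).

(** [osup f] denotes the least ordinal greater than all [f i], so that every
    ordinal has representatives; two of them denote the same ordinal when each
    is [ole] the other. *)

Inductive ord : Type := osup (T : Type) (f : T -> ord).

Fixpoint ole (a b : ord) {struct a} : Prop :=
  let: osup T f := a in
  let: osup U g := b in
  forall i, exists j, ole (f i) (g j).

Definition olt (a b : ord) : Prop :=
  let: osup U g := b in exists j, ole a (g j).

Definition ozero : ord := osup (fun x : void => match x with end).
Definition osucc (a : ord) : ord := osup (fun _ : unit => a).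
Definition oone : ord := osucc ozero.
Definition otwo : ord := osucc oone.

(** The trees below represent exactly the countable ordinals. *)
Inductive countable_ord : Type :=
| Czero
| Csup (f : nat -> countable_ord).

Fixpoint ord_of_countable (c : countable_ord) : ord :=
  match c with
  | Czero => ozero
  | Csup f => osup (fun n => ord_of_countable (f n))
  end.

Definition omega1 : ord := osup ord_of_countable.

Lemma ole_trans b a c : ole a b -> ole b c -> ole a c.
Proof.
elim: a b c => T f IH [U g] [V h] /= ab bc i.
have [j fg] := ab i; have [k gh] := bc j.
by exists k; exact: IH fg gh.
Qed.

Lemma olt_wf : well_founded olt.
Proof.
move=> a; suff: forall b, ole b a -> Acc olt b.
  by apply; elim: a => T f IH /= i; exists i.
elim: a => T f IH [U g] /= ba; constructor=> c [j cg].
by have [i gf] := ba j; apply: (IH i); exact: ole_trans cg gf.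
Qed.

Section Spaces.
Variable X : topologicalType.
Implicit Types (A B S U : set X) (NN : set (set X)) (x : X) (K : Type).

(** [A^(1)] *)
Definition seq_closure A : set X :=
  [set x | exists2 u : nat -> X, (forall n, A (u n)) & u @ \oo --> x].

Definition sequential_space := forall A, seq_closure A `<=` A -> closed A.

Definition frechet_urysohn := forall A, closure A `<=` seq_closure A.

(** [A^(a)] for [a >= 1]: [A^(1)], and for [a >= 2] the union over [1 <= b < a]
    of [(A^(b))^(1)]. The value at [ozero] is junk. *)
Definition seq_closure_iter A : ord -> set X :=
  Fix olt_wf (fun _ => set X) (fun a rec =>
    [set x | (~ ole otwo a /\ seq_closure A x) \/
             (ole otwo a /\ exists b (ba : olt b a),
                ole oone b /\ seq_closure (rec b ba) x)]).

Lemma seq_closure_iterE A a : seq_closure_iter A a =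
  [set x | (~ ole otwo a /\ seq_closure A x) \/
           (ole otwo a /\ exists b, [/\ olt b a, ole oone b &
              seq_closure (seq_closure_iter A b) x])].
Proof.
rewrite {1}/seq_closure_iter Fix_eq; last first.
  move=> b F F' FF'; congr mkset; apply/funext => x; congr (_ \/ (_ /\ _)).
  apply/propext; split=> -[c [cb ?]]; exists c, cb;
    by rewrite ?FF'// -FF'.
apply/seteqP; split=> x /= [?|[a2 [b [ba]]]]; first by left.
  by move=> [b1 bx]; right; split => //; exists b.
  by left.
by move=> b1 bx; right; split => //; exists b, ba.
Qed.

Definition seq_order_stable (a : ord) :=
  forall A, seq_closure_iter A (osucc a) = seq_closure_iter A a.

(** [a] is [so(X)] *)
Definition is_seq_order (a : ord) :=
  [/\ ole oone a, seq_order_stable a &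
      forall b, ole oone b -> seq_order_stable b -> ole a b].

Definition cs_star_network x NN :=
  forall U (u : nat -> X), nbhs x U -> u @ \oo --> x ->
    exists N, [/\ NN N, N `<=` U & infinite_set [set n | N (u n)]].

Definition cs_star_character : Type -> Prop :=
  sup_cardinal (fun x => least_size (cs_star_network x)).

Definition countable_cs_star_character :=
  exists2 K, cs_star_character K & countable [set: K].

Definition sequential_barrier x B :=
  forall u : nat -> X, u @ \oo --> x -> \forall n \near \oo, B (u n).

Definition sb_network x NN :=
  (forall N, NN N -> sequential_barrier x N) /\
  (forall U, nbhs x U -> exists N, [/\ NN N, N x & N `<=` U]).

Definition sb_character : Type -> Prop :=
  sup_cardinal (fun x => least_size (sb_network x)).

Definition inductive_topology (CC : set (set X)) :=
  forall F, closed F <->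
    (forall C, CC C -> closed (F `&` C : set (subspace C))).

Definition k_ness : Type -> Prop :=
  least_size (fun CC : set (set X) =>
    [/\ forall C, CC C -> compact C, \bigcup_(C in CC) C = [set: X] &
        inductive_topology CC]).

(** For the alpha_7 property a convergent sequence is a countable infinite
    set. *)
Definition set_converges S x :=
  [/\ countable S, infinite_set S & forall U, nbhs x U -> finite_set (S `\` U)].

Definition alpha7_space :=
  forall (S : nat -> set X) x, (forall n, set_converges (S n) x) ->
    exists T y, set_converges T y /\ infinite_set [set n | S n `&` T !=set0].

Definition baire_space :=
  forall F : nat -> set X, (forall n, open (F n) /\ dense (F n)) ->
    dense (\bigcap_n F n).

Definition metrizable (R : realType) :=
  exists d : X -> X -> R,
    [/\ forall x y, (0 <= d x y)%R,
        forall x y, d x y = 0%R <-> x = y,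
        forall x y, d x y = d y x,
        forall x y z, (d x z <= d x y + d y z)%R &
        forall x U, nbhs x U <->
          exists2 e : R, (0 < e)%R & [set y | (d x y < e)%R] `<=` U].

End Spaces.

Definition homeomorphic (X Y : topologicalType) :=
  exists (f : X -> Y) (g : Y -> X),
    [/\ cancel f g, cancel g f, continuous f & continuous g].

Definition contains_closed_copy (X Y : topologicalType) :=
  exists2 E : set X, closed E & homeomorphic E Y.

(** [ib(G)], the smallest cardinal [K] such that at most [K] left translates of
    any nonempty open set cover [G] *)
Definition boundedness_index (G : topologicalGroupType) : Type -> Prop :=
  least_cardinal (fun K => forall U : set G, open U -> U !=set0 ->
    exists2 F : set G, F #<= [set: K] &
      [set: G] = [set (x * y)%g | x in F & y in U]).

Section Arens.
Variable R : realType.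
Local Open Scope ring_scope.

(** The convergent sequences [C_0], [C_1], [C_2], ... *)
Definition arens_seq (k : nat) : set (R * R) :=
  if k == 0%N then
    [set p | p = (0, 0) \/ exists2 n, (0 < n)%N & p = (n%:R^-1, 0)]
  else
    [set p | p = (k%:R^-1, 0) \/
             exists2 m, (0 < m)%N & p = (k%:R^-1, (k * m)%:R^-1)].

Definition arens_set : set (R * R) := \bigcup_k arens_seq k.

Definition arens_space : Type := set_type arens_set.

HB.instance Definition _ := Choice.on arens_space.

(** The strongest topology inducing the planar topology on each [C_k]: a set is
    open when its trace on each [C_k] is open for the planar topology. *)
Definition arens_open (U : set arens_space) :=
  forall k, open (set_val @` U : set (subspace (arens_seq k))).

Let arens_openT : arens_open setT.
Proof.
move=> k; apply/open_subspaceP; exists setT; first exact: openT.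
rewrite setTI; apply/seteqP; split => p; last by case.
move=> kp; split => //.
have pA : p \in arens_set by rewrite inE; exists k.
by exists (exist _ p pA).
Qed.

Let arens_openI : setI_closed arens_open.
Proof.
move=> U V oU oV k.
rewrite (_ : _ @` _ = (set_val @` U) `&` (set_val @` V)).
  by apply: openI; [exact: oU|exact: oV].
apply/seteqP; split => p; first by move=> [x [Ux Vx] <-]; split; exists x.
move=> [[x Ux <-] [y Vy /val_inj yx]]; exists x => //; split => //.
by rewrite -yx.
Qed.

Let arens_open_bigU (I : Type) (f : I -> set arens_space) :
  (forall i, arens_open (f i)) -> arens_open (\bigcup_i f i).
Proof.
by move=> of_ k; rewrite image_bigcup; apply: bigcup_open => i _; exact: of_.
Qed.

HB.instance Definition _ := @isOpenTopological.Build arens_space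
  arens_open arens_openT arens_openI arens_open_bigU.

(** The sequential fan collapses [C_0] to a point. *)
Definition fan_rel (x y : arens_space) : bool :=
  (x == y) || ((set_val x \in arens_seq 0) && (set_val y \in arens_seq 0)).

Let fan_refl : reflexive fan_rel.
Proof. by move=> x; rewrite /fan_rel eqxx. Qed.

Let fan_sym : symmetric fan_rel.
Proof. by move=> x y; rewrite /fan_rel eq_sym andbC. Qed.

Let fan_trans : transitive fan_rel.
Proof.
move=> y x z; rewrite /fan_rel => /orP[/eqP->//|/andP[x0 y0]].
by move=> /orP[/eqP<-|/andP[_ z0]]; rewrite x0 ?y0 ?z0 orbT.
Qed.

Canonical fan_equiv := EquivRel fan_rel fan_refl fan_sym fan_trans.

Definition sequential_fan := quotient_topology {eq_quot fan_equiv}%qT.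

End Arens.

(* Main.v *)
Require Import Defs.
From HB Require Import structures.
From mathcomp Require Import all_boot all_order all_algebra generic_quotient.
From mathcomp Require Import all_classical all_reals all_analysis.
Import Order.TTheory GRing.Theory Num.Theory.
Import numFieldTopology.Exports.
Local Open Scope classical_set_scope.
Local Open Scope card_scope.

Set Implicit Arguments.
Unset Strict Implicit.
Unset Printing Implicit Defensive.

(** A fan is a double sequence [x n m] whose arms [x n] converge to [1] and none
    of whose transversals [n |-> x n (m n)] has a convergent subsequence.

    If [G] has no fan, then inside every neighborhood of [1] some finite union of
    products of members of the cs*-network is a sequential barrier at [1]. These
    countably many barriers can be used to pick diagonal sequences, so [G] is
    Frechet-Urysohn, hence first countable, hence metrizable.

    A fan cannot coexist with closed discrete infinite sets [d n] shrinking to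
    [1], because of the points [x n m * d n m]. So if [G] has a fan, then
    countably many sequentially compact sets catch all sequences converging to
    [1]. The argument above, relative to such a set, shows that these are compact
    with a countable base, and their products exhaust an open k_omega-subgroup by
    compact sets [C n]. Each of the nine conditions contradicts the fan or this
    exhaustion: for instance [G] is Weil complete since closed sets [A n] escaping
    from all [C n] have a neighborhood of [1] disjoint from all [C n ^-1 A n]; and
    sets of arbitrary countable sequential order are obtained by gluing sets of
    lower order, translated to the points of an arm of the fan. *)

(** Members of the cs*-network need not be neighborhoods of [1]. Products of them are needed because
    a limit [y] of a transversal may lie away from [1]: once [y] is a product of members, the terms
    near [y] are caught by products with one more factor. Words over a countable alphabet are
    countable, so a diagonal argument can run through all of them. All hypotheses are tested by
    sequences, hence sequential compactness comes first, and compactness only once a countable base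
    relative to the set is available. A sequentially compact set contains no fan, whatever the group
    contains, because a transversal in it would have a convergent subsequence; this is why barriers
    are taken relative to a set [L]. In [x n m * d n m] the first factor settles along arms and the
    second across arms, each where the other diverges, so convergent sequences of such products are
    constant along a subsequence. The two conditions on [ib] are counting arguments: translates of a
    small neighborhood that cover the group need infinitely many translating elements in each coset
    of the core, which pays for the countably many sets [C n] there. *)

(** * Subsequences and sequential compactness *)

Definition strictly_increasing (f : nat -> nat) := forall n, (f n < f n.+1)%N.

Lemma strictly_increasing_lt f : strictly_increasing f ->
  {homo f : m n / (m < n)%N}.
Proof.
move=> fi m n; elim: n => // n IH; rewrite ltnS leq_eqVlt => /orP[/eqP->|/IH mn].
  exact: fi.
exact: ltn_trans mn (fi n).
Qed.

Lemma strictly_increasing_ge f n : strictly_increasing f -> (n <= f n)%N.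
Proof. by move=> fi; elim: n => // n IH; exact: leq_ltn_trans IH (fi n). Qed.

Lemma strictly_increasing_comp f g : strictly_increasing f ->
  strictly_increasing g -> strictly_increasing (f \o g).
Proof. by move=> fi gi n; exact: (strictly_increasing_lt fi (gi n)). Qed.

Lemma subsequence_from (P : nat -> nat -> Prop) :
  (forall k m, exists2 n, (m <= n)%N & P k n) ->
  exists2 f, strictly_increasing f & forall k, P k (f k).
Proof.
move=> H; have {}H k m : {n | (m <= n)%N & P k n} by apply: cid2.
pose f := fix f k := if k is k'.+1 then s2val (H k'.+1 (f k').+1) else s2val (H 0 0).
exists f => [k|[|k]] /=; last 2 first.
- exact: (s2valP' (H 0 0)).
- exact: (s2valP' (H k.+1 (f k).+1)).
exact: (s2valP (H k.+1 (f k).+1)).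
Qed.

Lemma subsequence_of (P : nat -> Prop) :
  (forall m, exists2 n, (m <= n)%N & P n) ->
  exists2 f, strictly_increasing f & forall k, P (f k).
Proof. by move=> H; exact: (@subsequence_from (fun _ => P) (fun _ => H)). Qed.

Lemma frequentlyNP (P : nat -> Prop) :
  ~ (exists N, forall n, (N <= n)%N -> P n) ->
  forall m, exists2 n, (m <= n)%N & ~ P n.
Proof.
move=> H m; apply: contrapT => K; apply: H; exists m => n mn.
by apply: contrapT => nP; apply: K; exists n.
Qed.

(** If no value recurs infinitely often, [f] tends to infinity. Applied to the arm indices of points
    of a fan, the dichotomy says that a subsequence stays in one arm or runs along a transversal. *)
Lemma nat_subsequence (f : nat -> nat) :
  (exists c, exists2 p, strictly_increasing p & forall k, f (p k) = c) \/
  (exists2 p, strictly_increasing p & strictly_increasing (f \o p)).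
Proof.
case: (pselect (exists c, forall m, exists2 n, (m <= n)%N & f n = c)).
  by move=> [c /subsequence_of[p pi fp]]; left; exists c, p.
move=> H; right.
have {}H c : exists N, forall n, (N <= n)%N -> (c < f n)%N.
  elim: c => [|c [N IH]].
    apply: contrapT => /frequentlyNP K; apply: H; exists 0 => m.
    by have [n mn /negP] := K m; rewrite -leqNgt leqn0 => /eqP; exists n.
  apply: contrapT => /frequentlyNP K; apply: H; exists c.+1 => m.
  have [n] := K (maxn m N); rewrite geq_max => /andP[mn Nn] /negP.
  by rewrite -leqNgt => cn; exists n => //; apply/eqP; rewrite eqn_leq cn IH.
have [g Hg] := choice H.
pose p := fix p k := if k is k'.+1 then maxn (p k').+1 (g (f (p k'))) else 0.
exists p => n /=; first by rewrite leq_max ltnSn.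
by apply: Hg; rewrite leq_maxr.
Qed.

Section Sequences.
Variable X : topologicalType.
Implicit Types (u : nat -> X) (x : X).

Lemma cvg_seqP u x : u @ \oo --> x <->
  forall U, nbhs x U -> exists N, forall n, (N <= n)%N -> U (u n).
Proof.
split=> [ux U /ux[N _ NU]|H U /H[N NU]]; first by exists N => n /NU.
by exists N => // n /NU.
Qed.

Lemma cvg_subsequence u x f : strictly_increasing f -> u @ \oo --> x ->
  (u \o f) @ \oo --> x.
Proof.
move=> fi /cvg_seqP ux; apply/cvg_seqP => U /ux[N NU]; exists N => n Nn.
by apply: NU; apply: leq_trans Nn (strictly_increasing_ge _ fi).
Qed.

Lemma cvg_seq_eventually u v x N : (forall n, (N <= n)%N -> u n = v n) ->
  u @ \oo --> x -> v @ \oo --> x.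
Proof.
move=> uv /cvg_seqP ux; apply/cvg_seqP => U /ux[M MU].
exists (maxn M N) => n; rewrite geq_max => /andP[Mn Nn].
by rewrite -uv //; exact: MU.
Qed.

Lemma cvg_seq_cst (x : X) : (fun _ : nat => x) @ \oo --> x.
Proof. by apply/cvg_seqP => U xU; exists 0 => n _; exact: nbhs_singleton. Qed.

Lemma cvg_seq_in_closed u x A : closed A -> (forall n, A (u n)) ->
  u @ \oo --> x -> A x.
Proof.
move=> cA Au /cvg_seqP ux; apply: cA => U /ux[N NU].
by exists (u N); split => //; exact: NU.
Qed.

Lemma sequential_open : sequential_space X -> forall A : set X,
  (forall x u, A x -> u @ \oo --> x -> exists n, A (u n)) -> open A.
Proof.
move=> seqX A H; rewrite -closedC; apply: seqX => x [u uA ux] Ax.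
by have [n] := H x u Ax ux; exact: uA.
Qed.

Lemma sequential_closed : sequential_space X -> forall A : set X,
  (forall x u, (forall n, A (u n)) -> u @ \oo --> x -> A x) -> closed A.
Proof. by move=> seqX A H; apply: seqX => x [u uA ux]; exact: H ux. Qed.

Definition no_convergent_subsequence u :=
  forall f x, strictly_increasing f -> ~ (u \o f) @ \oo --> x.

Definition sequentially_compact (K : set X) :=
  forall u, (forall n, K (u n)) ->
    exists f, strictly_increasing f /\ exists2 x, K x & (u \o f) @ \oo --> x.

Lemma not_sequentially_compact A : closed A -> ~ sequentially_compact A ->
  exists2 u, (forall n, A (u n)) & no_convergent_subsequence u.
Proof.
move=> cA; apply: contra_notP => H u uA; apply: contrapT => K; apply: H.
exists u => // f x fi ux; apply: K; exists f; split => //; exists x => //.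
by apply: cvg_seq_in_closed ux => // n; exact: uA.
Qed.

Lemma no_convergent_subsequenceN u x : no_convergent_subsequence u ->
  ~ u @ \oo --> x.
Proof. by move=> /(_ id x) nu; apply: nu => n; exact: ltnSn. Qed.

Lemma no_convergent_subsequence_comp u f : strictly_increasing f ->
  no_convergent_subsequence u -> no_convergent_subsequence (u \o f).
Proof.
move=> fi nu g x gi; rewrite -compA; apply: nu.
exact: strictly_increasing_comp.
Qed.

Lemma sequentially_compact_no u A : sequentially_compact A ->
  no_convergent_subsequence u -> exists n, ~ A (u n).
Proof.
move=> cA nu; apply/existsNP => uA; have [f [fi [x _]]] := cA u uA.
exact: nu.
Qed.

Lemma sequentially_compactU A B : sequentially_compact A ->
  sequentially_compact B -> sequentially_compact (A `|` B).
Proof.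
move=> cA cB u uAB.
case: (pselect (exists N, forall n, (N <= n)%N -> A (u n))) => [[N NA]|].
  have ai : strictly_increasing (addn N) by move=> n; rewrite ltn_add2l.
  have [|f [fi [x Ax ux]]] := cA (u \o addn N).
    by move=> n; apply: NA; rewrite leq_addr.
  exists (addn N \o f); split; first exact: strictly_increasing_comp.
  by exists x => //; left.
move=> /frequentlyNP/subsequence_of[p pi pA].
have [|f [fi [x Bx ux]]] := cB (u \o p).
  by move=> n; have [/pA|] := uAB (p n).
exists (p \o f); split; first exact: strictly_increasing_comp.
by exists x => //; right.
Qed.

Lemma sequentially_compact1 x : sequentially_compact [set x].
Proof.
move=> u ux; exists id; split; first by [].
exists x => //; rewrite (_ : _ \o _ = fun _ => x); first exact: cvg_seq_cst.
by apply/funext => n; rewrite /= ux.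
Qed.

Lemma sequentially_compact_closed A : hausdorff_space X -> sequential_space X ->
  sequentially_compact A -> closed A.
Proof.
move=> hX seqX cA; apply: sequential_closed => // x u uA ux.
have [f [fi [y Ay uy]]] := cA u uA.
rewrite (_ : x = y) //; apply: (cvg_unique hX _ uy).
exact: cvg_subsequence ux.
Qed.

End Sequences.

(** * Sequences in topological groups *)

Section GroupSequences.
Variable G : topologicalGroupType.
Local Open Scope group_scope.
Implicit Types (x y z : G) (u v : nat -> G) (A B U V W : set G).

Lemma cvg_seqM u v x y : u @ \oo --> x -> v @ \oo --> y ->
  (fun n => u n * v n) @ \oo --> x * y.
Proof.
move=> ux vy; apply: (@cvg_comp _ _ _ (fun n => (u n, v n))
  (fun p : G * G => p.1 * p.2) _ (nbhs (x, y))); first exact: cvg_pair.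
exact: (@mulg_continuous G (x, y)).
Qed.

Lemma cvg_seqV u x : u @ \oo --> x -> (fun n => (u n)^-1) @ \oo --> x^-1.
Proof.
move=> ux; apply: (@cvg_comp _ _ _ u (fun p : G => p^-1) _ (nbhs x)) => //.
exact: (@invg_continuous G x).
Qed.

Lemma cvg_seqMl u x y : u @ \oo --> x -> (fun n => y * u n) @ \oo --> y * x.
Proof. by move=> ux; apply: cvg_seqM => //; exact: cvg_seq_cst. Qed.

Lemma cvg_seqVl u x : u @ \oo --> x -> (fun n => x^-1 * u n) @ \oo --> (1 : G).
Proof. by move=> /(@cvg_seqMl u x x^-1); rewrite mulVg. Qed.

Lemma nbhs_mull (y x : G) U : nbhs (y * x) U -> nbhs x [set z | U (y * z)].
Proof.
move=> nU; have cy : {for x, continuous (fun z : G => y * z)}.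
  apply: (@continuous_comp _ _ _ (fun z : G => (y, z))
    (fun p : G * G => p.1 * p.2)); last exact: mulg_continuous.
  by apply: cvg_pair => /=; [exact: cvg_cst|exact: cvg_id].
exact: cy.
Qed.

Lemma nbhs_translate x U : nbhs x U <-> nbhs 1 [set z | U (x * z)].
Proof.
split=> nU; first by apply: nbhs_mull; rewrite mulg1.
have := @nbhs_mull x^-1 x [set z | U (x * z)]; rewrite mulVg => /(_ nU).
by congr nbhs; apply/seteqP; split => z /=; rewrite mulVKg.
Qed.

Lemma nbhs_unit_split U : nbhs 1 U -> exists V,
  [/\ nbhs 1 V, forall x, V x -> V x^-1 & forall x y, V x -> V y -> U (x * y)].
Proof.
move=> nU; have : nbhs ((1, 1) : G * G) ((fun x : G * G => x.1 * x.2) @^-1` U).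
  by apply: mulg_continuous; rewrite /= mulg1.
move=> [[V W] /= [nV nW] VWU]; pose Z := V `&` W.
have nZ : nbhs 1 Z by exact: filterI.
exists (Z `&` [set x | Z x^-1]); split.
- by apply: filterI => //; apply: invg_continuous; rewrite invg1.
- by move=> x [Zx Zx']; split => //=; rewrite invgK.
- by move=> x y [[Vx _] _] [[_ Wy] _]; exact: (VWU (x, y)).
Qed.

(** Regularity: for [x] in the closure some [y] of [V] lies in [x * V], and [x = y * (x^-1 * y)^-1]
    is a product of two elements of the symmetric [V]. *)
Lemma nbhs_unit_closure U : nbhs 1 U -> exists2 V, nbhs 1 V & closure V `<=` U.
Proof.
move=> /nbhs_unit_split[V [nV Vs VU]]; exists V => // x /(_ [set z | V (x^-1 * z)]).
have /[swap]/[apply] : nbhs x [set z | V (x^-1 * z)].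
  by apply/nbhs_translate; rewrite /= (_ : [set _ | _] = V)//;
    apply/seteqP; split => z /=; rewrite mulKg.
move=> [y [Vy /= Vxy]]; have := VU _ _ Vy (Vs _ Vxy).
by rewrite invgM invgK mulVKg.
Qed.

Lemma nbhs_closure x V : nbhs x V -> exists2 W, nbhs x W & closure W `<=` V.
Proof.
move=> /nbhs_translate/nbhs_unit_closure[W nW WV].
exists [set z | W (x^-1 * z)].
  apply/nbhs_translate; rewrite /= (_ : [set _ | _] = W)//.
  by apply/seteqP; split => z /=; rewrite mulKg.
move=> z cz; rewrite -[z](mulVKg x); apply: WV => B nB.
have [y [Wy By]] : [set y | W (x^-1 * y)] `&` [set y | B (x^-1 * y)] !=set0.
  by apply: cz; exact: nbhs_mull.
by exists (x^-1 * y).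
Qed.

Lemma nbhs_open_unit U : nbhs 1 U -> exists V, [/\ open V, V 1 & V `<=` U].
Proof. by rewrite nbhsE => -[V [oV V1] VU]; exists V. Qed.

Hypothesis T1G : accessible_space G.

Lemma accessible_group_hausdorff : hausdorff_space G.
Proof.
move=> x y xy; have : closure [set x] y.
  apply: contrapT => yx.
  have cy : nbhs y (~` closure [set x]).
    by apply: open_nbhs_nbhs; split => //; apply: closed_openC; exact: closed_closure.
  move/nbhs_translate: cy => /nbhs_unit_split[V [nV Vs VU]].
  have nx : nbhs x [set z | V (x^-1 * z)].
    by apply/nbhs_translate; rewrite /= (_ : [set _ | _] = V)//;
      apply/seteqP; split => z /=; rewrite mulKg.
  have ny : nbhs y [set z | V (y^-1 * z)].
    by apply/nbhs_translate; rewrite /= (_ : [set _ | _] = V)//;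
      apply/seteqP; split => z /=; rewrite mulKg.
  have [z [/= Vxz Vyz]] := xy _ _ nx ny.
  have := VU _ _ Vyz (Vs _ Vxz); rewrite /= invgM invgK -mulgA !mulVKg.
  by apply; exact: subset_closure.
rewrite -(_ : [set x] = closure [set x]) => [->//|].
exact/closure_id/accessible_closed_set1.
Qed.

Lemma cvg_seq_unique u x y : u @ \oo --> x -> u @ \oo --> y -> x = y.
Proof. by move=> ux uy; exact: (cvg_unique accessible_group_hausdorff ux uy). Qed.

Lemma nbhs_unit_avoid x : x <> 1 -> exists2 V, nbhs 1 V & ~ V x.
Proof.
move=> x1; exists (~` [set x]); last by move=> /(_ erefl).
apply: open_nbhs_nbhs; split; last by move=> /= x1'; exact: x1.
by apply: closed_openC; exact: accessible_closed_set1.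
Qed.

Lemma cvg_seq_neq u x y : x <> y -> u @ \oo --> x ->
  exists N, forall n, (N <= n)%N -> u n <> y.
Proof.
move=> xy /cvg_seqP/(_ (~` [set y])); apply.
apply: open_nbhs_nbhs; split => //.
by apply: closed_openC; exact: accessible_closed_set1.
Qed.

End GroupSequences.

(** * Fans and sequential barriers *)

Section Dichotomy.
Variable G : topologicalGroupType.
Local Open Scope group_scope.
Implicit Types (x y z : G) (u v : nat -> G) (A B U V W L Q : set G).

Definition is_fan (x : nat -> nat -> G) :=
  (forall n, x n @ \oo --> (1 : G)) /\
  (forall m : nat -> nat, no_convergent_subsequence (fun n => x n (m n))).

Definition no_fan_in L := forall x : nat -> nat -> G,
  (forall n m, L (x n m)) -> ~ is_fan x.

Definition barrier_in L B := forall u, (forall n, L (u n)) ->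
  u @ \oo --> (1 : G) -> exists N, forall n, (N <= n)%N -> B (u n).

Definition unit_network (N : nat -> set G) := forall U u,
  nbhs 1 U -> u @ \oo --> (1 : G) ->
  exists2 i, N i `<=` U & forall m, exists2 n, (m <= n)%N & N i (u n).

Hypothesis seqG : sequential_space G.
Variable N : nat -> set G.
Hypothesis netN : unit_network N.

(** New letters multiply on the right: for a sequence converging to a point [y] of [word s], the
    quotients [y^-1 * u n] converge to [1], where a network member catches infinitely many of
    them. *)
Fixpoint word (s : seq nat) : set G :=
  if s is i :: s' then [set x * y | x in word s' & y in N i] else [set 1].

Let words (w : seq (seq nat)) : set G := [set x | exists2 s, s \in w & word s x].

(* The points reached inside [U] by a word with some room left form an open
   set: a sequence converging to such a point enters the next word. *)
Let room U : set G := [set x | exists s, word s x /\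
  exists2 V, nbhs 1 V & forall y z, word s y -> V z -> U (y * z)].

Let open_room U : open (room U).
Proof.
apply: sequential_open => // x u [s [sx [V nV VU]]] ux.
have [W [nW _ WV]] := nbhs_unit_split nV.
have [i NW /(_ 0)[n _ Nn]] := netN nW (cvg_seqVl ux).
exists n, (i :: s); split.
  by exists x => //; exists (x^-1 * u n) => //; rewrite mulVKg.
exists W => // _ z [y sy [t Nt <-]] Wz; rewrite -mulgA; apply: VU => //.
exact: WV (NW _ Nt) Wz.
Qed.

Let good U (k : nat) : seq (seq nat) :=
  [seq s <- pmap unpickle (iota 0 k) | `[< word s `<=` U >]].

(** If every union of words inside [U] fails, there are sequences converging to [1] in [L], the
    [k]-th one avoiding the words inside [U] of code less than [k]. They form a fan: kept in [W],
    they force the limit of a transversal into [room U], so infinitely many of its terms fall in one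
    longer word inside [U], which only finitely many of the sequences may meet. *)
Lemma exists_barrier_in L U : no_fan_in L -> nbhs 1 U ->
  exists w, barrier_in L (words w) /\ words w `<=` U.
Proof.
move=> nfL nU; apply: contrapT => nw.
have gU k : words (good U k) `<=` U.
  by move=> x [s]; rewrite mem_filter => /andP[/asboolP sU _] /sU.
have room1 : room U 1.
  by exists [::]; split => //; exists U => // y z -> Uz; rewrite mul1g.
have [W nW WO] : exists2 W, nbhs 1 W & closure W `<=` room U.
  apply: nbhs_unit_closure; apply: open_nbhs_nbhs; split => //.
have /choice[x Hx] k : exists u, u @ \oo --> (1 : G) /\
    forall n, [/\ L (u n), ~ words (good U k) (u n) & W (u n)].
  have : ~ barrier_in L (words (good U k)).
    by move=> bk; apply: nw; exists (good U k).
  move=> /existsNP[u /not_implyP[Lu /not_implyP[u1 /frequentlyNP K]]].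
  move/cvg_seqP: (u1) => /(_ W nW)[M MW].
  have [m|p pi pK] := @subsequence_of
      (fun n => ~ words (good U k) (u n) /\ W (u n)).
    have [n] := K (maxn m M); rewrite geq_max => /andP[mn Mn] nb.
    by exists n => //; split => //; exact: MW.
  exists (u \o p); split; first exact: cvg_subsequence.
  by move=> n; have [? ?] := pK n; split => //; exact: Lu.
apply: (nfL x) => [n m|]; first by have [_ /(_ m)[]] := Hx n.
split=> [n|m f y fi ty]; first by have [] := Hx n.
have : room U y.
  apply: WO; apply: (cvg_seq_in_closed (@closed_closure _ _) _ ty) => n.
  by apply: subset_closure => /=; have [_ /(_ (m (f n)))[]] := Hx (f n).
move=> [s [sy [V nV VU]]].
have [i NV /(_ (pickle (i :: s)).+1)[n cn Nn]] := netN nV (cvg_seqVl ty).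
have [_ /(_ (m (f n)))[_ + _]] := Hx (f n); apply; exists (i :: s).
  rewrite mem_filter; apply/andP; split.
    by apply/asboolP => _ [z sz [t /NV Vt <-]]; exact: VU.
  rewrite mem_pmap; apply/mapP; exists (pickle (i :: s)); last by rewrite pickleK.
  by rewrite mem_iota /= add0n (leq_trans cn)// strictly_increasing_ge.
by exists y => //; exists (y^-1 * x (f n) (m (f n))) => //; rewrite mulVKg.
Qed.

Lemma countable_barriers_in L : no_fan_in L -> exists B : nat -> set G,
  [/\ forall n, B n.+1 `<=` B n, forall n, barrier_in L (B n) &
      forall U, nbhs 1 U -> exists n, B n `<=` U].
Proof.
move=> nfL.
(* [E n] is the union coded by [n] if that is a barrier and the whole group otherwise, so that
   finite intersections are always barriers. *)
pose E n := if unpickle n is Some w then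
  [set x | barrier_in L (words w) -> words w x] else setT.
have bE n : barrier_in L (E n).
  rewrite /E; case: unpickle => [w u Lu u1|u _ _]; last by exists 0.
  case: (pselect (barrier_in L (words w))) => [b|nb].
    by have [M MB] := b u Lu u1; exists M => k /MB ? /=.
  by exists 0 => k _ /= /nb.
pose B := fix B n := if n is n'.+1 then B n' `&` E n'.+1 else E 0.
exists B; split => [n x []//|n|U nU].
  elim: n => [|n IH]; first exact: bE.
  move=> u Lu u1; have [M MB] := IH u Lu u1; have [M' ME] := bE n.+1 u Lu u1.
  by exists (maxn M M') => k; rewrite geq_max => /andP[/MB ? /ME].
have [w [bw wU]] := exists_barrier_in nfL nU; exists (pickle w).
apply: subset_trans wU => x; have : B (pickle w) `<=` E (pickle w).
  by case: (pickle w) => [|n] //= y [].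
by move=> /[apply]; rewrite /E pickleK; apply.
Qed.

(** Convergence of a sequence of [Q] to a point of [Q] becomes convergence to [1] of a sequence of
    these quotients, to which the barriers at [1] apply. *)
Definition left_quotient L : set G := [set x^-1 * y | x in L & y in L].

(** A diagonal sequence: if [u n] is a limit of points of [A], one of them is [u n * b n] with [b n]
    in the [n]-th barrier. The barriers shrink to [1], so [u n * b n] has the same limit as [u]. *)
Lemma seq_closure_closed Q A : closed Q -> no_fan_in (left_quotient Q) ->
  A `<=` Q -> closed (seq_closure A).
Proof.
move=> cQ /countable_barriers_in[B [Bs bB Bb]] AQ.
apply: sequential_closed => // x u uA ux.
have Qu n : Q (u n).
  by have [v vA vu] := uA n; apply: (cvg_seq_in_closed cQ _ vu) => k; exact: AQ.
have /choice[b Hb] n : exists b, A (u n * b) /\ B n b.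
  have [v vA vu] := uA n.
  have [k|K /(_ K (leqnn K)) BK] := bB n _ _ (cvg_seqVl vu).
    by exists (u n) => //; exists (v k) => //; exact: AQ.
  by exists ((u n)^-1 * v K); rewrite mulVKg.
exists (fun n => u n * b n) => [n|]; first by have [] := Hb n.
rewrite -[x]mulg1; apply: cvg_seqM => //; apply/cvg_seqP => U nU.
have [n BU] := Bb U nU; exists n => k nk; apply: BU.
have : B k `<=` B n.
  elim: k nk => [|k IH]; first by rewrite leqn0 => /eqP->.
  by rewrite leq_eqVlt => /orP[/eqP->//|/IH]; exact: subset_trans.
by apply; have [] := Hb k.
Qed.

(** Barriers are not open, so [U n] is the complement of the closure of [Q] minus the [n]-th
    barrier. It contains [1] because that closure is reached by single sequences, and a sequence of
    [Q] converging to [1] ends up in the barrier. *)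
Lemma countable_local_base_in Q : closed Q -> Q 1 ->
  no_fan_in (left_quotient Q) -> exists U : nat -> set G,
  [/\ forall n, open (U n) /\ U n 1, forall n, U n.+1 `<=` U n &
      forall W, nbhs 1 W -> exists n, U n `&` Q `<=` W].
Proof.
move=> cQ Q1 nfQ; have [B [Bs bB Bb]] := countable_barriers_in nfQ.
exists (fun n => ~` closure (Q `\` B n)); split => [n|n|W nW].
- split; first by apply: closed_openC; exact: closed_closure.
  have : closure (Q `\` B n) `<=` seq_closure (Q `\` B n).
    rewrite (closure_id (seq_closure _)).1; last first.
      by apply: (seq_closure_closed cQ nfQ) => x [].
    apply: closureS => x Bx; exists (fun _ => x) => //; exact: cvg_seq_cst.
  move=> /[apply] -[u Qu u1].
  have [k|K /(_ K (leqnn K))] := bB n u _ u1; last by have [] := Qu K.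
  by exists 1 => //; exists (u k); [have [] := Qu k|rewrite invg1 mul1g].
- by apply: subsetC; apply: closureS => x [Qx nB]; split => // /Bs.
have [n BW] := Bb W nW; exists n => x [nx Qx]; apply: BW; apply: contrapT => nB.
by apply: nx; apply: subset_closure.
Qed.

End Dichotomy.

(** * Metrization of first countable groups *)

Section Metrization.
Local Open Scope ring_scope.

(** The distance is the infimum of the radii [e] with [ball x e y]; the bound [b] keeps the set of
    radii nonempty. *)
Lemma bounded_pseudometric_metrizable (R : realType) (T : pseudoMetricType R)
  (b : R) : hausdorff_space T -> 0 < b -> (forall x y : T, ball x b y) ->
  metrizable T R.
Proof.
move=> hT b0 bb; pose E (x y : T) : set R := [set e : R | 0 < e /\ ball x e y].
have hE x y : has_inf (E x y).
  by split; [exists b|exists 0 => e [/ltW]].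
have dlt x y e : (inf (E x y) < e) -> ball x e y.
  by move=> /(inf_lt (hE x y).1)[e' [_ xy] /ltW ee']; exact: le_ball ee' _ xy.
have dle x y e : 0 < e -> ball x e y -> inf (E x y) <= e.
  by move=> e0 xy; apply: ge_inf; [exact: (hE x y).2|].
have d0 x y : 0 <= inf (E x y).
  by apply: lb_le_inf; [exact: (hE x y).1|move=> e [/ltW]].
exists (fun x y => inf (E x y)); split => //.
- move=> x y; split => [xy0|->].
    apply: hT => A B /nbhs_ballP[e e0 xA] /nbhs_ballP[e' e'0 yB].
    exists y; split; last by apply: yB; exact: ballxx.
    by apply: xA; apply: dlt; rewrite xy0.
  apply/eqP; rewrite eq_le d0 andbT; apply/ler_addgt0Pl => e e0.
  by rewrite addr0; apply: dle => //; exact: ballxx.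
- by move=> x y; congr inf; apply/seteqP; split => e [e0 /ball_sym].
- move=> x y z; apply/ler_addgt0Pl => e e0.
  have e2 : 0 < e / 2 by rewrite divr_gt0.
  rewrite (_ : e + _ = (inf (E x y) + e / 2) + (inf (E y z) + e / 2)); last first.
    by rewrite addrACA -splitr addrC.
  apply: dle; first by rewrite addr_gt0 // ltr_wpDl // d0.
  by apply: (@ball_triangle _ _ y); apply: dlt; rewrite ltrDl.
- move=> x U; split=> [/nbhs_ballP[e e0 xU]|[e e0 xU]].
    by exists e => // y /dlt /xU.
  apply/nbhs_ballP; exists (e / 2); first exact: divr_gt0.
  move=> y xy; apply: xU => /=; apply: (@le_lt_trans _ _ (e / 2)).
    by apply: dle => //; exact: divr_gt0.
  by rewrite ltr_pdivrMr// ltr_pMr// ltr1n.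
Qed.

(** Birkhoff-Kakutani: a countable base at [1] yields a countable base of the left uniformity, hence
    a pseudometric. *)
Lemma first_countable_group_metrizable (R : realType) (G : topologicalGroupType)
  (U : nat -> set G) : accessible_space G -> (forall n, nbhs (1%g : G) (U n)) ->
  (forall W, nbhs (1%g : G) W -> exists n, U n `<=` W) -> metrizable G R.
Proof.
move=> T1G nU bU; have cu : countable_uniformity (left_uniform G).
  apply/countable_uniformityP; exists (fun n => left_ent (U n)).
    move=> A [W nW WA]; have [n UW] := bU W nW.
    by exists n => p Up; apply: WA; exact: UW.
  by move=> n; exists (U n).
(* Any two points lie in a common ball of radius [2] of the pseudometric built from a countable
   uniformity. *)
have := @bounded_pseudometric_metrizable R (countable_uniform cu) 2.
apply => //; first exact: accessible_group_hausdorff T1G.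
exact: countable_uniform.countable_uniform_bounded.
Qed.

End Metrization.

(** * Fans and closed discrete sets *)

Section Fan.
Variable G : topologicalGroupType.
Local Open Scope group_scope.
Implicit Types (x y z : G) (u v : nat -> G) (A B U V W L Q : set G).
Hypothesis T1G : accessible_space G.
Hypothesis seqG : sequential_space G.

Lemma nonmetrizable_fan (R : realType) (N : nat -> set G) : unit_network N ->
  ~ metrizable G R -> exists x : nat -> nat -> G, is_fan x.
Proof.
move=> netN nmG; apply: contrapT => nf; apply: nmG.
have [|U [oU _ bU]] := countable_local_base_in seqG netN (@closedT G) I.
  by move=> x _ fx; apply: nf; exists x.
apply: (@first_countable_group_metrizable R G U) => // [n|W /bU[n]].
  by apply: open_nbhs_nbhs; have [] := oU n.
by rewrite setIT => ?; exists n.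
Qed.

Variable x : nat -> nat -> G.
Hypothesis fanx : is_fan x.

(** Points chosen on the arms [f k] only are completed to a full transversal, with index [0] on the
    other arms. *)
Lemma fan_transversal (f m : nat -> nat) : strictly_increasing f ->
  no_convergent_subsequence (fun k => x (f k) (m k)).
Proof.
move=> fi.
pose m' n := if pselect (exists k, f k = n) is left e then m (projT1 (cid e)) else 0.
have <- : (fun n => x n (m' n)) \o f = (fun k => x (f k) (m k)).
  apply/funext => k /=; congr x; rewrite /m'.
  case: pselect => [e|[]]; last by exists k.
  case: cid => /= k' fk; congr m; case: (ltngtP k' k) => //.
    by move/(strictly_increasing_lt fi); rewrite fk ltnn.
  by move/(strictly_increasing_lt fi); rewrite fk ltnn.
by apply: no_convergent_subsequence_comp => //; exact: fanx.2.
Qed.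

(* The points [x n m * d n m] form a sequentially closed set having [1] as a
   cluster point. *)
Lemma fan_excludes_metric_fan (d : nat -> nat -> G) :
  (forall n, no_convergent_subsequence (d n)) ->
  ~ (forall U, nbhs 1 U ->
      exists N, forall n, (N <= n)%N -> forall m, U (d n m)).
Proof.
move=> nd d1.
pose A := [set z | z <> 1 /\ exists n m, z = x n m * d n m].
have cA : closed A.
  apply: sequential_closed => // z u uA uz.
  have /choice[n /choice[m um]] k : exists n, exists m, u k = x n m * d n m.
    by have [_] := uA k.
  (* If the arm is constant along a subsequence, either [m] is too and [z] is the repeated value, or
     [x c] tends to [1] and [d c] would have a convergent subsequence. If the arms increase, [d]
     tends to [1] and a transversal of the fan would converge. *)
  case: (nat_subsequence n) => [[c [p pi np]]|[p pi ni]].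
    case: (nat_subsequence (m \o p)) => [[e [q qi mq]]|[q qi mi]].
      rewrite -(_ : u (p (q 0)) = z) //.
      have uq : (fun _ : nat => u (p (q 0))) @ \oo --> z.
        apply: (cvg_seq_eventually (N := 0)
          _ (cvg_subsequence qi (cvg_subsequence pi uz))).
        by move=> k _; rewrite /= !um !np; move: (mq k) (mq 0) => /= -> ->.
      exact: (cvg_seq_unique T1G (@cvg_seq_cst _ _) uq).
    exfalso; apply: (nd c (m \o p \o q) (1^-1 * z) mi).
    apply: (cvg_seq_eventually (N := 0) _ (cvg_seqM
      (cvg_seqV (cvg_subsequence mi (fanx.1 c)))
      (cvg_subsequence qi (cvg_subsequence pi uz)))).
    by move=> k _; rewrite /= um np mulKg.
  exfalso; apply: (no_convergent_subsequenceN (x := z)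
    (@fan_transversal _ (m \o p) ni)).
  rewrite -[z]mulg1 -[X in z * X]invg1.
  have dn : (fun k => d (n (p k)) (m (p k))) @ \oo --> (1 : G).
    apply/cvg_seqP => U /d1[M MU]; exists M => k Mk; apply: MU.
    exact: leq_trans Mk (strictly_increasing_ge _ ni).
  apply: (cvg_seq_eventually (N := 0) _
    (cvg_seqM (cvg_subsequence pi uz) (cvg_seqV dn))).
  by move=> k _; rewrite /= um mulgK.
(* Late products in a far arm [M] lie outside [A], hence equal [1]. Then [d M] is eventually the
   inverse of [x M] and converges. *)
have : nbhs 1 (~` A).
  by apply: open_nbhs_nbhs; split; [exact: closed_openC|case].
move=> /nbhs_unit_split[V [nV _ VA]]; have [M MV] := d1 V nV.
have /cvg_seqP/(_ V nV)[K KV] := fanx.1 M.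
apply: (nd M (addn K) (1^-1)); first by move=> k; rewrite ltn_add2l.
have ai : strictly_increasing (addn K) by move=> k; rewrite ltn_add2l.
apply: (cvg_seq_eventually (N := 0) _
  (cvg_seqV (cvg_subsequence ai (fanx.1 M)))) => k _ /=.
have := VA _ _ (KV _ (leq_addr k K)) (MV M (leqnn M) (K + k)%N).
move=> /not_andP[/contrapT|]; last by case; exists M, (K + k)%N.
by move/(congr1 (fun z => (x M (K + k)%N)^-1 * z)); rewrite mulKg mulg1.
Qed.

(* Were no finite intersection of good unions sequentially compact, closed
   discrete sequences in them would form a metric fan. *)
Lemma sequentially_compact_cover (N : nat -> set G) : unit_network N ->
  (forall i, closed (N i)) -> exists K : nat -> set G,
    (forall i, sequentially_compact (K i)) /\
    forall u, u @ \oo --> (1 : G) ->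
      exists i N, forall n, (N <= n)%N -> K i (u n).
Proof.
move=> netN cN.
pose un (w : seq nat) := [set z | exists2 i, i \in w & N i z].
have cun w : closed (un w).
  elim: w => [|i w IH]; first by rewrite (_ : un _ = set0);
    [exact: closed0|apply/seteqP; split => // z []].
  rewrite (_ : un _ = N i `|` un w); first exact: closedU.
  apply/seteqP; split => z.
    move=> [j]; rewrite inE => /orP[/eqP->|jw Nj]; first by left.
    by right; exists j.
  by move=> [Nz|[j jw Nj]]; [exists i|exists j] => //; rewrite inE ?eqxx ?jw ?orbT.
pose meet (s : seq (seq nat)) := [set z | forall w, w \in s -> un w z].
have cmeet s : closed (meet s).
  rewrite (_ : meet s = \bigcap_(w in [set` s]) un w).
    by apply: closed_bigI => w _; exact: cun.
  by apply/seteqP; split => z.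
(* The countable family has to be fixed before [u] is given: it lists all the meets, with the empty
   set in place of those that are not sequentially compact. *)
pose K n := if unpickle n is Some s then
  [set z | sequentially_compact (meet s) /\ meet s z] else set0.
have sc0 : sequentially_compact (@set0 G) by move=> u /(_ 0).
exists K; split => [n|u u1].
  rewrite /K; case: unpickle => // s.
  case: (pselect (sequentially_compact (meet s))) => sm.
    by rewrite (_ : [set z | _] = meet s)//; apply/seteqP; split => z // [].
  by rewrite (_ : [set z | _] = set0)//; apply/seteqP; split => z // [].
pose good (w : seq nat) := exists M, forall n, (M <= n)%N -> un w (u n).
have goodU U : nbhs 1 U -> exists2 w, good w & un w `<=` U.
  move=> nU; pose ws k := [seq i <- iota 0 k | `[< N i `<=` U >]].
  have wsU k : un (ws k) `<=` U.
    by move=> z [i]; rewrite mem_filter => /andP[/asboolP iU _] /iU.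
  (* Otherwise a subsequence of [u] has its [k]-th term outside the first [k] members that lie in
     [U], so no such member contains infinitely many of its terms. *)
  apply: contrapT => ng.
  have nws k m : exists2 n, (m <= n)%N & ~ un (ws k) (u n).
    by move: m; apply: frequentlyNP => -[M H]; apply: ng; exists (ws k) => //; exists M.
  have [p pi pw] := subsequence_from (P := fun k n => ~ un (ws k) (u n)) nws.
  have [i NU /(_ i.+1)[k ik Nk]] := netN U _ nU (cvg_subsequence pi u1).
  apply: (pw k); exists i => //; rewrite mem_filter; apply/andP.
  by split; [exact/asboolP|rewrite mem_iota].
pose goods k := [seq w <- pmap unpickle (iota 0 k) | `[< good w >]].
have meetS k w : good w -> (pickle w < k)%N -> meet (goods k) `<=` un w.
  move=> gw wk z; apply; rewrite mem_filter; apply/andP; split; first exact/asboolP.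
  rewrite mem_pmap; apply/mapP; exists (pickle w); last by rewrite pickleK.
  by rewrite mem_iota.
have [k sk] : exists k, sequentially_compact (meet (goods k)).
  apply/not_existsP => nk.
  have /choice[d Hd] k : exists d : nat -> G,
      (forall n, meet (goods k) (d n)) /\ no_convergent_subsequence d.
    have [d dk nd] := not_sequentially_compact (cmeet (goods k)) (nk k).
    by exists d.
  apply: (@fan_excludes_metric_fan d) => [n|U nU]; first by have [] := Hd n.
  have [w gw wU] := goodU U nU; exists (pickle w).+1 => n wn m; apply: wU.
  by apply: (meetS _ _ gw wn); have [] := Hd n.
exists (pickle (goods k)); rewrite /K pickleK.
suff [M HM] : exists M, forall n, (M <= n)%N -> meet (goods k) (u n).
  by exists M => n /HM.
have : forall w, w \in goods k -> good w.
  by move=> w; rewrite mem_filter => /andP[/asboolP].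
elim: (goods k) => [|w s IH] gs; first by exists 0.
have [|M HM] := IH.
  by move=> v vs; apply: gs; rewrite inE vs orbT.
have [M' HM'] := gs w (mem_head _ _).
exists (maxn M M') => n; rewrite geq_max => /andP[/HM ms /HM' mw] v.
by rewrite inE => /orP[/eqP->|/ms].
Qed.

End Fan.

(** * Products and compactness of sequentially compact sets *)

Section SequentiallyCompactProducts.
Variable G : topologicalGroupType.
Local Open Scope group_scope.
Implicit Types (x y z : G) (u v : nat -> G) (A B D K : set G).

Lemma sequentially_compactM A B : sequentially_compact A ->
  sequentially_compact B -> sequentially_compact [set x * y | x in A & y in B].
Proof.
move=> cA cB u uAB; have /choice[a Ha] k : exists a, A a /\ B (a^-1 * u k).
  by have [a Aa [b Bb <-]] := uAB k; exists a; rewrite mulKg.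
have [f [fi [x Ax ax]]] := cA a (fun k => (Ha k).1).
have [g [gi [y By xy]]] := cB (fun k => (a (f k))^-1 * u (f k)) (fun k => (Ha _).2).
exists (f \o g); split; first exact: strictly_increasing_comp.
exists (x * y); first by exists x => //; exists y.
apply: (cvg_seq_eventually (N := 0) _ (cvg_seqM (cvg_subsequence gi ax) xy)).
by move=> k _; rewrite /= mulVKg.
Qed.

Lemma sequentially_compactV A : sequentially_compact A ->
  sequentially_compact [set x | A x^-1].
Proof.
move=> cA u uA; have [f [fi [x Ax ax]]] := cA (fun k => (u k)^-1) uA.
exists f; split => //; exists x^-1; first by rewrite /= invgK.
apply: (cvg_seq_eventually (N := 0) _ (cvg_seqV ax)).
by move=> k _; rewrite /= invgK.
Qed.

Lemma sequentially_compact_left_quotient A : sequentially_compact A ->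
  sequentially_compact (left_quotient A).
Proof.
move=> cA; rewrite (_ : left_quotient A =
  [set x * y | x in [set x | A x^-1] & y in A]); last first.
  apply/seteqP; split => _ [x Ax [y Ay <-]].
    by exists x^-1; rewrite /= ?invgK//; exists y.
  by exists x^-1 => //; exists y => //; rewrite invgK.
by apply: sequentially_compactM => //; exact: sequentially_compactV.
Qed.

Lemma sequentially_compact_no_fan A : sequentially_compact A -> no_fan_in A.
Proof.
move=> cA x xA [_ /(_ (fun _ => 0))/(sequentially_compact_no cA)[n]].
by apply; exact: xA.
Qed.

Hypothesis T1G : accessible_space G.
Hypothesis seqG : sequential_space G.
Variable N : nat -> set G.
Hypothesis netN : unit_network N.
Variable K : set G.
Hypothesis cK : sequentially_compact K.

Lemma countable_local_base_quotient : exists U : nat -> set G,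
  [/\ forall n, open (U n) /\ U n 1, forall m n, (m <= n)%N -> U n `<=` U m &
      forall W, nbhs 1 W -> exists n, U n `&` left_quotient K `<=` W].
Proof.
(* The point [1] is added for the case of an empty [K]. *)
pose Q := [set 1] `|` left_quotient K.
have cQ : sequentially_compact Q.
  apply: sequentially_compactU; first exact: sequentially_compact1.
  exact: sequentially_compact_left_quotient.
have [|||U [oU Us bU]] := countable_local_base_in seqG netN (Q := Q).
- by apply: sequentially_compact_closed => //; exact: accessible_group_hausdorff.
- by left.
- exact/sequentially_compact_no_fan/sequentially_compact_left_quotient.
exists U; split => // [m n|W /bU[n nW]].
  elim: n => [|n IH]; first by rewrite leqn0 => /eqP->.
  by rewrite leq_eqVlt => /orP[/eqP->//|/IH]; exact: subset_trans.
by exists n; apply: subset_trans nW => x [? ?]; split => //; right.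
Qed.

Section Cover.
Variable U : nat -> set G.
Hypothesis oU : forall n, open (U n) /\ U n 1.
Hypothesis Us : forall m n, (m <= n)%N -> U n `<=` U m.
Hypothesis bU : forall W, nbhs 1 W -> exists n, U n `&` left_quotient K `<=` W.

(** Total boundedness: points of [K] chosen greedily, each outside the [U n]-translates of the
    earlier ones, would have a convergent subsequence, two terms of which are [U n]-close. *)
Lemma finite_net n : exists s : seq G, (forall x, x \in s -> K x) /\
  forall z, K z -> exists2 x, x \in s & U n (x^-1 * z).
Proof.
apply: contrapT => ns.
have /choice[F HF] (s : seq G) : exists z, (forall x, x \in s -> K x) ->
    K z /\ forall x, x \in s -> ~ U n (x^-1 * z).
  case: (pselect (forall x, x \in s -> K x)) => [sK|nsK]; last by exists 1.
  apply: contrapT => nz; apply: ns; exists s; split => // z Kz.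
  apply: contrapT => nx; apply: nz; exists z => _; split => // x xs Ux.
  by apply: nx; exists x.
pose S := fix S k := if k is k'.+1 then F (S k') :: S k' else [::].
have SK k : forall x, x \in S k -> K x.
  elim: k => [|k IH] //= x; rewrite inE => /orP[/eqP->|/IH//].
  by have [] := HF _ IH.
have S_lt k i : (i < k)%N -> F (S i) \in S k.
  elim: k => // k IH; rewrite ltnS leq_eqVlt => /orP[/eqP->|ik] /=.
    by rewrite inE eqxx.
  by rewrite inE IH ?orbT.
have [f [fi [x Kx fx]]] := cK (fun k => (HF _ (SK k)).1).
have nU : nbhs 1 (U n) by apply: open_nbhs_nbhs; exact: oU.
have [V [nV Vs VU]] := nbhs_unit_split nU.
have /cvg_seqP/(_ V nV)[M MV] := cvg_seqVl fx.
have [_] := HF _ (SK (f M.+1)).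
apply; first by apply: S_lt; exact: (fi M).
have := VU _ _ (Vs _ (MV M (leqnn M))) (MV M.+1 (leqnSn M)).
by rewrite /= invgM invgK -mulgA mulVKg.
Qed.

(* Some [U n] is a Lebesgue number for the given neighborhoods. *)
Lemma sequentially_compact_induction (P : set G -> Prop) :
  P set0 -> (forall A B, P A -> P B -> P (A `|` B)) ->
  (forall A B, A `<=` B -> P B -> P A) ->
  (forall x, K x -> exists2 W, nbhs x W & P (W `&` K)) -> P K.
Proof.
move=> P0 PU PS PK.
have [n nP] : exists n, forall x, K x -> P ([set z | U n (x^-1 * z)] `&` K).
  apply: contrapT => H.
  have /choice[x Hx] n : exists x, K x /\ ~ P ([set z | U n (x^-1 * z)] `&` K).
    apply: contrapT => nx; apply: H; exists n => x Kx.
    by apply: contrapT => xP; apply: nx; exists x.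
  have [f [fi [y Ky xy]]] := cK (fun n => (Hx n).1).
  have [W nW WP] := PK y Ky.
  move/nbhs_translate: nW => /nbhs_unit_split[V [nV Vs VW]].
  have [n UV] := bU nV.
  have /cvg_seqP/(_ V nV)[M MV] := cvg_seqVl xy.
  pose k := maxn n M; apply: (Hx (f k)).2; apply: PS WP => z [/= Uz Kz].
  split => //; have := VW _ _ (MV k (leq_maxr _ _)) (UV ((x (f k))^-1 * z) _).
  rewrite /= mulgA mulVKg mulVKg; apply; split.
    apply: Us Uz; apply: leq_trans (leq_maxl _ M) _.
    exact: strictly_increasing_ge.
  by exists (x (f k)); [exact: (Hx _).1|exists z].
have [s [sK Ks]] := finite_net n.
have : P ([set z | exists2 x, x \in s & U n (x^-1 * z)] `&` K).
  elim: s sK {Ks} => [|x s IH] sK; first by apply: PS P0 => z [[]].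
  apply: (PS _ (([set z | U n (x^-1 * z)] `&` K) `|`
    ([set z | exists2 x, x \in s & U n (x^-1 * z)] `&` K))).
    move=> z [[y]]; rewrite inE => /orP[/eqP->|ys] Uy Kz; first by left.
    by right; split => //; exists y.
  apply: PU; first by apply: nP; apply: sK; rewrite inE eqxx.
  by apply: IH => y ys; apply: sK; rewrite inE ys orbT.
by apply: PS => z Kz; split => //; exact: Ks.
Qed.

End Cover.

(** The induction runs over the sets missed by some member of the filter. Without a cluster point in
    [K] they include a neighborhood in [K] of each point, hence [K] itself, which belongs to the
    filter. *)
Lemma sequentially_compact_compact : compact K.
Proof.
move=> F FF FK; apply: contrapT => nc.
have [U [oU Us bU]] := countable_local_base_quotient.
have : exists2 B, F B & K `&` B = set0.
  apply: (sequentially_compact_induction oU Us bU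
    (P := fun A => exists2 B, F B & A `&` B = set0)).
  - by exists setT; [exact: filterT|rewrite set0I].
  - move=> A B [A' FA AA] [B' FB BB]; exists (A' `&` B'); first exact: filterI.
    rewrite -subset0 => z [[Az|Bz] [A'z B'z]]; first by rewrite -AA.
    by rewrite -BB.
  - move=> A B AB [B' FB BB]; exists B' => //; rewrite -subset0 -BB => z [? ?].
    by split => //; exact: AB.
  move=> x Kx; apply: contrapT => nW; apply: nc; exists x; split => // A B FA nB.
  apply: contrapT => AB; apply: nW; exists B => //; exists A => //.
  by rewrite -subset0 => z [[Bz _] Az]; apply: AB; exists z.
move=> [B FB KB]; apply: (@filter_not_empty _ F).
by rewrite -KB; exact: filterI.
Qed.

End SequentiallyCompactProducts.

(** * Open k_omega-subgroups *)

Section KOmega.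
Variable G : topologicalGroupType.
Local Open Scope group_scope.
Implicit Types (x y z : G) (u v : nat -> G) (A B D K : set G).

(** The middle clauses make the union of the sets a subgroup. The last one, translated, puts the
    tail of any convergent sequence of that subgroup in a single [C n], so that closedness can be
    tested on these sets. *)
Definition k_omega (C : nat -> set G) :=
  [/\ forall n, sequentially_compact (C n), forall n, C n 1,
      forall n x, C n x -> C n x^-1,
      forall n x y, C n x -> C n y -> C n.+1 (x * y) &
      forall u, u @ \oo --> (1 : G) ->
        exists n N, forall k, (N <= k)%N -> C n (u k)].

Lemma sequentially_compact_cover_k_omega (K : nat -> set G) :
  (forall i, sequentially_compact (K i)) ->
  (forall u, u @ \oo --> (1 : G) ->
      exists i N, forall n, (N <= n)%N -> K i (u n)) ->
  exists C, k_omega C.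
Proof.
move=> cK KG; pose D A i := A `|` (K i `|` [set x | K i x^-1]).
pose C := fix C n := if n is n'.+1
  then [set x * y | x in D (C n') n' & y in D (C n') n'] else [set (1 : G)].
have C1 n : C n 1.
  by elim: n => //= n IH; exists 1; [left|exists 1; [left|rewrite mulg1]].
exists C; split=> // [n|n x|n x y Cx Cy|u /KG[i [M MK]]].
- elim: n => [|n IH] /=; first exact: sequentially_compact1.
  apply: sequentially_compactM; apply: sequentially_compactU => //;
    by apply: sequentially_compactU => //; exact: sequentially_compactV.
- elim: n x => [x ->|n IH x]; first by rewrite invg1.
  have DV z : D (C n) n z -> D (C n) n z^-1.
    by move=> [/IH Cz|[Kz|Kz]]; [left|right; right; rewrite /= invgK|right; left].
  by move=> [y Dy [z Dz <-]]; exists z^-1; [exact: DV|exists y^-1;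
    [exact: DV|rewrite invgM]].
- by exists x; [left|exists y; [left|]].
exists i.+1, M => k /MK Kk; exists (u k); first by right; left.
by exists 1; [left|rewrite mulg1].
Qed.

Hypothesis T1G : accessible_space G.
Hypothesis seqG : sequential_space G.
Variable C : nat -> set G.
Hypothesis kC : k_omega C.

Lemma k_omega_closed n : closed (C n).
Proof.
case: kC => cC _ _ _ _; apply: sequentially_compact_closed => //.
exact: accessible_group_hausdorff.
Qed.

Lemma k_omega_le m n : (m <= n)%N -> C m `<=` C n.
Proof.
case: kC => _ C1 _ CM _; elim: n => [|n IH]; first by rewrite leqn0 => /eqP->.
rewrite leq_eqVlt => /orP[/eqP->//|/IH mn] x /mn Cx.
by rewrite -[x]mulg1; exact: CM.
Qed.

Definition k_core : set G := [set x | exists n, C n x].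

Lemma k_core1 : k_core 1. Proof. by case: kC => _ C1 _ _ _; exists 0. Qed.

Lemma k_coreV x : k_core x -> k_core x^-1.
Proof. by case: kC => _ _ CV _ _ [n Cx]; exists n; exact: CV. Qed.

Lemma k_coreM x y : k_core x -> k_core y -> k_core (x * y).
Proof.
case: kC => _ _ _ CM _ [m Cx] [n Cy]; exists (maxn m n).+1.
by apply: CM; [exact: k_omega_le (leq_maxl _ _) _ Cx|
  exact: k_omega_le (leq_maxr _ _) _ Cy].
Qed.

Lemma k_core_mull x y : k_core x -> k_core (x * y) <-> k_core y.
Proof.
move=> Hx; split; last exact: k_coreM.
by move=> /(k_coreM (k_coreV Hx)); rewrite mulKg.
Qed.

Lemma k_core_cvg u x : k_core x -> u @ \oo --> x ->
  exists n N, C n x /\ forall k, (N <= k)%N -> C n (u k).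
Proof.
case: (kC) => _ _ _ CM CN [m Cx] /cvg_seqVl/CN[n [N Nn]].
exists (maxn m n).+1, N; split=> [|k /Nn Ck].
  by apply: (k_omega_le _ Cx); rewrite leqW// leq_maxl.
rewrite -[u k](mulVKg x); apply: CM; first exact: k_omega_le (leq_maxl _ _) _ Cx.
exact: k_omega_le (leq_maxr _ _) _ Ck.
Qed.

Lemma k_core_open : open k_core.
Proof.
apply: sequential_open => // x u Hx /(k_core_cvg Hx)[n [N [_ /(_ N (leqnn N))]]].
by exists N, n.
Qed.

Lemma k_core_closed : closed k_core.
Proof.
apply: sequential_closed => // x u Hu /cvg_seqVl.
have /k_core_cvg /[apply] := k_core1 => -[n [N [_ /(_ N (leqnn N))]]] Cn.
rewrite -[x]invgK -(k_core_mull _ (k_coreV (Hu N))) -invgM.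
by apply: k_coreV; exists n.
Qed.

Lemma k_core_cvg_seq u x : (forall n, k_core (u n)) -> u @ \oo --> x ->
  exists n N, C n x /\ forall k, (N <= k)%N -> C n (u k).
Proof.
move=> Hu ux; apply: k_core_cvg => //.
exact: cvg_seq_in_closed k_core_closed Hu ux.
Qed.

(* If [a = c z] with [a] in [A n], [c] in [C n] and [z] in [C i], then [n < i],
   so that every [C i] meets finitely many of the sets [C n ^-1 A n]. *)
Lemma escaping_sets_nbhs (A : nat -> set G) :
  (forall n, closed (A n)) -> (forall n x, A n x -> ~ C n.+1 x) ->
  exists V, [/\ open V, V 1, V `<=` k_core &
    forall n c z, C n c -> V z -> ~ A n (c * z)].
Proof.
move=> cA AC; case: (kC) => cC C1 CV CM CN.
pose Z := [set z | k_core z /\ exists n c, C n c /\ A n (c * z)].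
have cZ : closed Z.
  apply: sequential_closed => // z u uZ uz.
  have [i [M [Cz Cu]]] := k_core_cvg_seq (fun n => (uZ n).1) uz.
  have /choice[n /choice[c Hc]] k : exists n c, C n c /\ A n (c * u k).
    by have [_ [n [c Hc]]] := uZ k; exists n, c.
  have [[e [p pi np]]|[p pi npi]] := nat_subsequence n; last first.
    (* Once [n (p k)] is at least [i], both factors lie in [C (n (p k))] and their product in the
       next set, which [A (n (p k))] avoids; hence the successor in the hypothesis. *)
    pose k := maxn i M; have [Cc] := Hc (p k); move/AC; case.
    have ik : (i <= n (p k))%N.
      apply: leq_trans (leq_maxl _ _ : (_ <= k)%N) _.
      exact: strictly_increasing_ge npi.
    apply: CM => //; apply: k_omega_le ik _ _; apply: Cu.
    exact: leq_trans (leq_maxr _ _) (strictly_increasing_ge _ pi).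
  have [k|f [fi [x Cx cx]]] := cC e (c \o p); first by have [] := Hc (p k);
    rewrite np.
  split; first by exists i.
  exists e, x; split => //; apply: (cvg_seq_in_closed (cA e) _
    (cvg_seqM cx (cvg_subsequence fi (cvg_subsequence pi uz)))) => k.
  by have [_] := Hc (p (f k)); rewrite np.
exists (k_core `&` ~` Z); split.
- by apply: openI; [exact: k_core_open|exact: closed_openC].
- split; first exact: k_core1.
  move=> [_ [n [c [Cc]]]]; rewrite mulg1 => /AC; apply.
  by rewrite -[c]mulg1; exact: CM.
- by move=> x [].
- by move=> n c v Cc [Hv nZ] Acv; apply: nZ; split => //; exists n, c.
Qed.

End KOmega.

Lemma infinite_set_nat (A : set nat) : infinite_set A ->
  forall m, exists2 n, (m <= n)%N & A n.
Proof.
move=> iA m; apply: contrapT => nA; apply: iA.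
apply: (sub_finite_set _ (finite_II m)) => n An /=.
by rewrite ltnNge; apply/negP => mn; apply: nA; exists n.
Qed.

(** * Consequences of a fan *)

Section FanConsequences.
Variable G : topologicalGroupType.
Local Open Scope group_scope.
Implicit Types (y z : G) (u : nat -> G) (A B U V W L Q : set G).
Hypothesis T1G : accessible_space G.
Hypothesis seqG : sequential_space G.

(** Only finitely many arms contain [1], since otherwise some partial transversal is constantly [1].
    After dropping them, terms are reselected along an enumeration of the pairs, each new one
    differing from all earlier ones. *)
Lemma injective_fan (x : nat -> nat -> G) : is_fan x ->
  exists y : nat -> nat -> G, [/\ is_fan y, forall n m, y n m <> 1 &
    forall n m n' m', y n m = y n' m' -> n = n' /\ m = m'].
Proof.
move=> fx; have [N0 HN0] : exists N0, forall n, (N0 <= n)%N -> forall m, x n m <> 1.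
  apply: contrapT => /frequentlyNP H.
  have [f fi Hf] : exists2 f, strictly_increasing f &
      forall k, exists m, x (f k) m = 1.
    apply: (@subsequence_of (fun n => exists m, x n m = 1)) => m.
    have [n mn /existsNP[k /contrapT xk]] := H m.
    by exists n => //; exists k.
  have /choice[m Hm] := Hf.
  apply: (no_convergent_subsequenceN (x := 1)
    (@fan_transversal _ _ fx _ m fi)).
  by apply: (cvg_seq_eventually (N := 0) _ (@cvg_seq_cst _ 1)) => k _ /=.
have /choice[F HF] (p : seq G * (nat * nat)) :
    exists m, (p.2.2 <= m)%N /\ x (N0 + p.2.1)%N m \notin p.1.
  move: p => [s [n k]] /=.
  have [M HM] : exists M, forall m, (M <= m)%N -> x (N0 + n)%N m \notin s.
    elim: s => [|v s [M HM]]; first by exists 0.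
    have [M' HM'] : exists M', forall m, (M' <= m)%N -> x (N0 + n)%N m <> v.
      case: (pselect (1 = v)) => [<-|v1].
        by exists 0 => m _; apply: HN0; rewrite leq_addr.
      exact: (cvg_seq_neq T1G v1 (fx.1 _)).
    exists (maxn M M') => m; rewrite geq_max inE negb_or => /andP[/HM -> /HM'].
    by move=> /eqP ->.
  by exists (maxn M k); split; [exact: leq_maxr|apply: HM; exact: leq_maxl].
pose code c : nat * nat := odflt (0, 0) (unpickle c).
pose value s c := x (N0 + (code c).1)%N (F (s, code c)).
pose S := fix S c := if c is c'.+1 then value (S c') c' :: S c' else [::].
have S_lt c i : (i < c)%N -> value (S i) i \in S c.
  elim: c => // c IH; rewrite ltnS leq_eqVlt => /orP[/eqP->|ic] /=.
    by rewrite inE eqxx.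
  by rewrite inE IH ?orbT.
have S_neq c i : (i < c)%N -> value (S i) i <> value (S c) c.
  move=> /S_lt + e; rewrite e; apply/negP.
  by have [_] := HF (S c, code c).
have codeK n k : code (pickle (n, k)) = (n, k) by rewrite /code pickleK.
exists (fun n k => value (S (pickle (n, k))) (pickle (n, k))).
split=> [|n m|n m n' m' e].
- split=> [n|m].
    apply/cvg_seqP => U nU.
    have /cvg_seqP/(_ U nU)[M HM] := fx.1 (N0 + n)%N.
    exists M => k Mk; rewrite /value codeK; apply: HM.
    by apply: leq_trans Mk _; have [] := HF (S (pickle (n, k)), (n, k)).
  rewrite [X in no_convergent_subsequence X](_ : _ = fun n => x (addn N0 n)
      (F (S (pickle (n, m n)), (n, m n)))); last first.
    by apply/funext => n; rewrite /value codeK.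
  by apply: fan_transversal => // n; rewrite ltn_add2l.
- by apply: HN0; rewrite leq_addr.
suff: (n, m) = (n', m') by case.
apply: (pcan_inj pickleK); case: (ltngtP (pickle (n, m)) (pickle (n', m'))) => //.
  by move=> /S_neq; rewrite e.
by move=> /S_neq; rewrite e.
Qed.

Variable x : nat -> nat -> G.
Hypothesis fanx : is_fan x.
Hypothesis x_neq1 : forall n m, x n m <> 1.
Hypothesis x_inj : forall n m n' m', x n m = x n' m' -> n = n' /\ m = m'.

Lemma fan_sequence_bounded (n m : nat -> nat) y :
  (fun k => x (n k) (m k)) @ \oo --> y ->
  exists c p, strictly_increasing p /\ forall k, n (p k) = c.
Proof.
move=> xy; case: (nat_subsequence n) => [[c [p pi np]]|[p pi npi]].
  by exists c, p.
exfalso; apply: (no_convergent_subsequenceN (x := y)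
    (@fan_transversal _ _ fanx _ (m \o p) npi)).
exact: (cvg_subsequence pi xy).
Qed.

(** A convergent sequence of [A] returns infinitely often to one arm, where only finitely many
    positions are available, so it repeats its limit. *)
Lemma fan_finite_arms_closed A : A `<=` [set x n m | n in setT & m in setT] ->
  (forall n, exists M, forall m, (M <= m)%N -> ~ A (x n m)) -> closed A.
Proof.
move=> Ax finA; apply: sequential_closed => // z u uA uz.
have /choice[n /choice[m xu]] k : exists n m, x n m = u k.
  by have [n _ [m _ <-]] := Ax _ (uA k); exists n, m.
have [c [p [pi np]]] : exists c p, strictly_increasing p /\ forall k, n (p k) = c.
  apply: (@fan_sequence_bounded n m z).
  by apply: (cvg_seq_eventually (N := 0) _ uz).
have [M HM] := finA c.
case: (nat_subsequence (m \o p)) => [[e [q qi mq]]|[q qi mi]]; last first.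
  exfalso; apply: (HM (m (p (q M)))); first exact: strictly_increasing_ge mi.
  by rewrite -(np (q M)) xu; exact: uA.
rewrite (_ : z = u (p (q 0))) //; have uq : (fun _ : nat => u (p (q 0))) @ \oo --> z.
  apply: (cvg_seq_eventually (N := 0)
    _ (cvg_subsequence qi (cvg_subsequence pi uz))) => k _ /=.
  by rewrite -!xu !np; move: (mq k) (mq 0) => /= -> ->.
exact: (cvg_seq_unique T1G uq (@cvg_seq_cst _ _)).
Qed.

(** The iterated limit of [y n * x n m] is [1], but no sequence of such products other than [1]
    reaches it: inside one arm the limit [1] would force [y c] or the product to be [1], and across
    arms division by [y n] leaves a convergent transversal. *)
Lemma fan_not_frechet_urysohn : ~ frechet_urysohn G.
Proof.
move=> FU; pose y := x 0.
pose A := [set z | z <> 1 /\ exists n m, z = y n * x n m].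
have Ay n : closure A (y n).
  move=> U nU; have yx : (fun m => y n * x n m) @ \oo --> y n.
    by rewrite -[X in _ --> X]mulg1; apply: cvg_seqMl; exact: fanx.1.
  have [M HM] := cvg_seq_neq T1G (@x_neq1 0 n) yx.
  move/cvg_seqP: yx => /(_ U nU)[M' HM'].
  exists (y n * x n (maxn M M')); split; last by apply: HM'; exact: leq_maxr.
  by split; [apply: HM; exact: leq_maxl|exists n, (maxn M M')].
have /FU[u uA u1] : closure A 1.
  by apply: (cvg_seq_in_closed (@closed_closure _ _) Ay); exact: fanx.1.
have /choice[n /choice[m um]] k : exists n m, u k = y n * x n m by have [] := uA k.
case: (nat_subsequence n) => [[c [p pi np]]|[p pi ni]].
  have xp : (fun k => x c (m (p k))) @ \oo --> (y c)^-1 * 1.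
    apply: (cvg_seq_eventually (N := 0) _ (cvg_seqMl (y := (y c)^-1)
      (cvg_subsequence pi u1))).
    by move=> k _; rewrite /= um np mulKg.
  rewrite mulg1 in xp.
  case: (nat_subsequence (m \o p)) => [[e [q qi mq]]|[q qi mi]].
    have e1 : x c e = (y c)^-1.
      apply: (cvg_seq_unique T1G (@cvg_seq_cst _ _)).
      apply: (cvg_seq_eventually (N := 0) _ (cvg_subsequence qi xp)) => k _ /=.
      by have /= -> := mq k.
    have [+ _] := uA (p (q 0)); rewrite um np; have /= -> := mq 0.
    by rewrite e1 mulgV.
  have /(congr1 (fun z => z^-1)) : (y c)^-1 = 1.
    apply: (cvg_seq_unique T1G (cvg_subsequence qi xp)).
    exact: (cvg_subsequence mi (fanx.1 c)).
  by rewrite invgK invg1; exact: x_neq1.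
apply: (no_convergent_subsequenceN (x := 1^-1 * 1)
    (@fan_transversal _ _ fanx _ (m \o p) ni)).
apply: (cvg_seq_eventually (N := 0) _ (cvg_seqM
  (cvg_seqV (cvg_subsequence ni (fanx.1 0))) (cvg_subsequence pi u1))).
by move=> k _; rewrite /= um mulKg.
Qed.

(** A convergent set meeting infinitely many arms contains a transversal of those arms; injectivity
    turns finiteness of a set of points into finiteness of the set of indices. *)
Lemma fan_not_alpha7 : ~ alpha7_space G.
Proof.
move=> a7; have [|T [y [[_ _ Ty] iT]]] := a7 (fun n => range (x n)) 1.
  move=> n; split.
  - exact: sub_countable (card_image_le _ _) (countableP _).
  - rewrite (eq_finite_set (B := [set: nat])); first exact: infinite_nat.
    by apply: inj_card_eq => m m' _ _ /x_inj[].
  move=> U nU; have /cvg_seqP/(_ U nU)[M HM] := fanx.1 n.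
  apply: (sub_finite_set _ (finite_image (x n) (finite_II M))).
  move=> _ [[m _ <-] nUx]; exists m => //=; rewrite ltnNge; apply/negP => Mm.
  by apply: nUx; exact: HM.
have [f fi Hf] := subsequence_of (infinite_set_nat iT).
have /choice[m Hm] k : exists m, T (x (f k) m).
  by have [_ [[m _ <-] Tx]] := Hf k; exists m.
apply: (no_convergent_subsequenceN (x := y)
    (@fan_transversal _ _ fanx _ m fi)).
apply/cvg_seqP => U /Ty fU; apply: contrapT => /frequentlyNP H.
have {H} : infinite_set [set k | ~ U (x (f k) (m k))].
  move=> /finite_setP[n]; have [g gi Hg] := subsequence_of H.
  move=> /eq_finite_set; rewrite (_ : finite_set `I_n = True); last first.
    by apply/propext; split => // _; exact: finite_II.
  move=> e; have : finite_set [set k | ~ U (x (f k) (m k))] by rewrite e.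
  move=> fs; apply: infinite_nat; rewrite -(eq_finite_set (A := range g)).
    by apply: sub_finite_set fs => _ [k _ <-]; exact: Hg.
  apply: inj_card_eq => i j _ _ gij; case: (ltngtP i j) => //.
    by move/(strictly_increasing_lt gi); rewrite gij ltnn.
  by move/(strictly_increasing_lt gi); rewrite gij ltnn.
apply; rewrite -(eq_finite_set
  (A := (fun k => x (f k) (m k)) @` [set k | ~ U (x (f k) (m k))])).
  by apply: sub_finite_set fU => _ [k nU <-].
apply: inj_card_eq => i j _ _ /x_inj[fij _]; case: (ltngtP i j) => //.
  by move/(strictly_increasing_lt fi); rewrite fij ltnn.
by move/(strictly_increasing_lt fi); rewrite fij ltnn.
Qed.

(** A barrier [B] contains the arm [n] from some index [h B n] on. The points [x n m] with
    [m <= f n] form a closed set without [1], and a barrier missing that set has [h B] above [f]. *)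
Lemma fan_sb_network_dominating (NN : set (set G)) : sb_network 1 NN ->
  exists2 D : set (nat -> nat), D #<= NN &
    forall f, exists2 g, D g & forall n, (f n <= g n)%N.
Proof.
move=> [bN nN].
have /choice[h Hh] (B : set G) : exists h : nat -> nat, NN B ->
    forall n m, (h n <= m)%N -> B (x n m).
  case: (pselect (NN B)) => [NB|]; last by exists id.
  have /choice[h Hh] n : exists M, forall m, (M <= m)%N -> B (x n m).
    by have [M _ HM] := bN B NB _ (fanx.1 n); exists M => m Mm; exact: HM.
  by exists h.
exists (h @` NN); first exact: card_image_le.
move=> f; pose E := [set z | exists n m, z = x n m /\ (m <= f n)%N].
have cE : closed E.
  apply: fan_finite_arms_closed => [_ [n [m [-> _]]]|n]; first by exists n => //; exists m.
  exists (f n).+1 => m fm [n' [m' [/x_inj[<- <-]]]].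
  by rewrite leqNgt fm.
have nE : nbhs 1 (~` E).
  apply: open_nbhs_nbhs; split; first exact: closed_openC.
  by move=> [n [m [/esym/x_neq1]]].
have [B [NB _ BE]] := nN _ nE; exists (h B); first by exists B.
move=> n; rewrite leqNgt; apply/negP => hf.
apply: (BE (x n (f n))); first by apply: Hh NB _ _ _; exact: ltnW.
by exists n, (f n).
Qed.

(** The nonempty open core is covered by the closed sets [C n], so one of them has an interior point
    [c]. It then contains [c] times a transversal, which contradicts its sequential compactness. *)
Lemma fan_not_baire (C : nat -> set G) : k_omega C -> ~ baire_space G.
Proof.
move=> kC bG; have cC := k_omega_closed T1G seqG kC.
have [n [c cn]] : exists n (c : G), nbhs c (C n).
  apply: contrapT => nC.
  have H n : open (~` C n) /\ dense (~` C n).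
    split; first exact: closed_openC.
    move=> O [c Oc] oO; apply: contrapT => OC; apply: nC; exists n, c.
    apply: filterS (open_nbhs_nbhs (conj oO Oc)) => z Oz.
    by apply: contrapT => Cz; apply: OC; exists z.
  have [||z [[n Cn]]] := bG _ H (k_core C).
  - by exists 1; exact: k_core1.
  - exact: k_core_open.
  by move=> /(_ n I).
move/nbhs_translate: cn => cn.
have /choice[m Hm] k : exists m, C n (c * x k m).
  by have /cvg_seqP/(_ _ cn)[M HM] := fanx.1 k; exists M; exact: HM.
have [f [fi [z _ fz]]] : exists f, strictly_increasing f /\
    exists2 z, C n z & ((fun k => c * x k (m k)) \o f) @ \oo --> z.
  by case: kC => sC _ _ _ _; exact: sC.
apply: (fanx.2 m f (c^-1 * z) fi).
apply: (cvg_seq_eventually (N := 0) _ (cvg_seqMl (y := c^-1) fz)) => k _ /=.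
by rewrite mulKg.
Qed.

End FanConsequences.

(** * Comparing cardinalities by injections *)

Section Cardinals.
Variables T U : Type.
Implicit Types (A : set T) (B : set U).

Lemma injection_card_le A B (f : T -> U) : (forall x, A x -> B (f x)) ->
  (forall x y, A x -> A y -> f x = f y -> x = y) -> A #<= B.
Proof.
move=> fB fI; have fA : f @` A #= A.
  by apply: inj_card_eq => x y; rewrite !inE => Ax Ay; exact: fI.
rewrite -(card_le_eql fA); apply: subset_card_le => _ [x Ax <-]; exact: fB.
Qed.

Lemma card_le_injection A B (b : U) : A #<= B -> exists f : T -> U,
  (forall x, A x -> B (f x)) /\ forall x y, A x -> A y -> f x = f y -> x = y.
Proof.
move=> /card_leP[g].
pose f x := if pselect (A x) is left Ax
  then set_val (g (exist _ x (mem_set Ax))) else b.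
exists f; split => [x Ax|x y Ax Ay]; rewrite /f.
  by case: pselect => // Ax'; exact: set_valP.
case: pselect => // Ax'; case: pselect => // Ay' /val_inj.
by move=> /(inj (f := g)); rewrite !inE => /(_ I I)[].
Qed.

Lemma finite_set_frequently A (f : nat -> T) : finite_set A ->
  (forall n, A (f n)) -> exists a, forall m, exists2 n, (m <= n)%N & f n = a.
Proof.
move=> fA Af; apply: contrapT => H; apply: infinite_nat.
rewrite (_ : [set: nat] = \bigcup_(a in A) (f @^-1` [set a])); last first.
  by apply/seteqP; split => n // _; exists (f n).
apply: bigcup_finite => // a Aa; apply: contrapT => /infinite_set_nat fa.
by apply: H; exists a.
Qed.

End Cardinals.

(** * Completeness and cardinality *)

Section KOmegaConsequences.
Variable G : topologicalGroupType.
Local Open Scope group_scope.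
Implicit Types (y z : G) (u : nat -> G) (A B U V W L Q : set G).
Hypothesis T1G : accessible_space G.
Hypothesis seqG : sequential_space G.
Variable C : nat -> set G.
Hypothesis kC : k_omega C.
Hypothesis compactC : forall n, compact (C n).

Let closed_translate A z : closed A -> closed [set y | A (z * y)].
Proof.
move=> cA; apply: sequential_closed => // y u uA uy.
exact: (cvg_seq_in_closed cA uA (cvg_seqMl uy)).
Qed.

(* A Cauchy filter all of whose closed members meet [x0 * C n] clusters there;
   if there were no such [n], the closed members missing [x0 * C n] would
   escape from all the compact sets at once. *)
Lemma k_omega_weil_complete : weil_complete G.
Proof.
move=> F FF cF.
have cauchyF V : nbhs 1 V -> exists2 P : set G, F P &
    forall x y, P x -> P y -> V (x^-1 * y).
  move=> nV; have : @entourage (left_uniform G) (left_ent V) by exists V.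
  move=> /cF[[P Q] [FP FQ] PQ]; exists (P `&` Q); first exact: filterI.
  by move=> x y [Px _] [_ Qy]; exact: (PQ (x, y)).
have nH : nbhs 1 (k_core C).
  by apply: open_nbhs_nbhs; split; [exact: k_core_open|exact: k_core1].
have [P FP PH] := cauchyF _ nH.
have [x0 Px0] : P !=set0 := filter_ex FP.
have [n meetn] : exists n, forall B : set G, F B ->
    exists c, C n c /\ closure B (x0 * c).
  apply: contrapT => H.
  have /choice[B HB] n : exists B : set G, F B /\
      forall c, C n.+1 c -> ~ closure B (x0 * c).
    apply: contrapT => nB; apply: H; exists n.+1 => B FB.
    apply: contrapT => nc; apply: nB; exists B; split => // c Cc Bc.
    by apply: nc; exists c.
  have [V [oV V1 _ VB]] := @escaping_sets_nbhs G seqG C kC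
    (fun n => [set z | closure (B n) (x0 * z)])
    (fun n => closed_translate (@closed_closure _ _))
    (fun n z Bz Cz => (HB n).2 z Cz Bz).
  (* A point [x] of [P'] lies in [x0 * C n] for some [n], and [P'] in [x * V]; so [B n] misses [P'],
     although both belong to the filter. *)
  have [P' FP' PV] := cauchyF V (open_nbhs_nbhs (conj oV V1)).
  have [x [Px P'x]] : P `&` P' !=set0 by apply: (@filter_ex _ F); exact: filterI.
  have [n Cn] := PH _ _ Px0 Px.
  have [z [Bz P'z]] : B n `&` P' !=set0.
    by apply: (@filter_ex _ F); apply: filterI => //; have [] := HB n.
  apply: (VB n _ _ Cn (PV _ _ P'x P'z)); apply: subset_closure.
  by rewrite /= -mulgA !mulVKg.
(* The traces generate a filter on the compact set [C n]; its cluster point [c] makes [x0 * c] a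
   cluster point of [F], hence a limit since [F] is Cauchy. *)
pose trace (B : set G) := [set c | C n c /\ closure B (x0 * c)].
have FT : ProperFilter (filter_from F trace).
  apply: filter_from_proper; last by move=> B /meetn[c Cc]; exists c.
  apply: filter_from_filter; first by exists setT; exact: filterT.
  move=> A B FA FB; exists (A `&` B); first exact: filterI.
  by move=> c [Cc /closureI[]].
have [|c [_ clc]] := @compactC n _ FT.
  by exists setT; [exact: filterT|move=> c []].
have clB (B : set G) : F B -> closure B (x0 * c).
  move=> FB U nU; have [d [[_ Bd] Ud]] : trace B `&`
      [set z | interior U (x0 * z)] !=set0.
    by apply: clc; [exists B|apply: nbhs_mull; exact: nbhs_interior].
  exact: Bd.
exists (x0 * c) => U /nbhs_translate nU.
have [W [nW _ WU]] := nbhs_unit_split nU.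
have [P' FP' PW] := cauchyF W nW.
have [q [P'q Wq]] : P' `&` [set z | W ((x0 * c)^-1 * z)] !=set0.
  apply: clB => //; apply/nbhs_translate.
  by rewrite /= (_ : [set _ | _] = W)//; apply/seteqP; split => z /=; rewrite mulKg.
apply: filterS FP' => z P'z; have := WU _ _ Wq (PW _ _ P'q P'z).
by rewrite /= mulgA !mulVKg.
Qed.

Section Translates.
Variable x : nat -> nat -> G.
Hypothesis fanx : is_fan x.

Let coset z : set G := [set y | k_core C (z^-1 * y)].

Let cosetE z y : coset z y -> coset z = coset y.
Proof.
move=> zy; apply/seteqP; split => t /= zt.
  by have := k_coreM kC (k_coreV kC zy) zt; rewrite invgM invgK -mulgA mulVKg.
by have := k_coreM kC zy zt; rewrite -mulgA mulVKg.
Qed.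

Let coset_refl z : coset z z.
Proof. by rewrite /coset /= mulVg; exact: k_core1. Qed.

(* No coset of the core is covered by finitely many translates of a suitable
   neighborhood, since the points of a transversal can be separated. *)
Lemma infinite_translates : exists W, [/\ open W, W 1 &
  forall F : set G, [set: G] = [set y * z | y in F & z in W] ->
    forall g, infinite_set (F `&` coset g)].
Proof.
have /choice[m Hm] k : exists m, k_core C (x k m).
  have /cvg_seqP/(_ (k_core C))[|M HM] := fanx.1 k.
    by apply: open_nbhs_nbhs; split; [exact: k_core_open|exact: k_core1].
  by exists M; exact: HM.
(* A tail of the transversal inside the sequentially compact [C n.+1] would have a convergent
   subsequence. *)
have outside n k : exists2 k', (k <= k')%N & ~ C n.+1 (x k' (m k')).
  move: k; apply: frequentlyNP => -[M HM]; case: kC => cC _ _ _ _.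
  have ai : strictly_increasing (addn M) by move=> k; rewrite ltn_add2l.
  have [k] := sequentially_compact_no (cC n.+1) (fan_transversal fanx (m := m \o addn M) ai).
  by apply; apply: HM; rewrite leq_addr.
have [p pi Hp] := subsequence_from (P := fun n k => ~ C n.+1 (x k (m k))) outside.
pose t k := x (p k) (m (p k)).
have At n z : [set t n] z -> ~ C n.+1 z by move=> ->; exact: Hp.
have [V [oV V1 VH VA]] := @escaping_sets_nbhs G seqG C kC (fun n => [set t n])
  (fun n => accessible_closed_set1 T1G (x := t n)) At.
have [W' [nW' W's W'V]] := nbhs_unit_split (open_nbhs_nbhs (conj oV V1)).
have [W [oW W1 WW']] := nbhs_open_unit nW'.
have WH z : W z -> k_core C z.
  move=> Wz; apply: VH; rewrite -[z]mulg1; apply: W'V; first exact: WW'.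
  exact: nbhs_singleton.
exists W; split => // F FW g finF.
have /choice[f Hf] k : exists f, F f /\ W (f^-1 * (g * t k)).
  have : [set: G] (g * t k) by [].
  by rewrite FW => -[f Ff [w Ww fw]]; exists f; rewrite -fw mulKg.
have [k|e ef] := finite_set_frequently (f := f) finF _.
  split; first by have [] := Hf k.
  have [_ /WH/(k_coreV kC)] := Hf k; rewrite !invgM invgK.
  by move=> /(k_coreM kC (Hm (p k))); rewrite -/(t k) !mulgA mulgV mul1g.
(* Two points [t i] and [t j] share a translate, with [j] so large that [t i] lies in [C j]. Then
   [(t i)^-1 * t j] lies in [V], and [t i] times it is the point [t j] that [V] was chosen to
   exclude. *)
have [i _ fi] := ef 0; have [n Cn] := Hm (p i).
have [j nj fj] := ef n.
apply: (VA j (t i) ((t i)^-1 * t j)); last by rewrite mulVKg.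
  exact: k_omega_le nj _ Cn.
have [_] := Hf i; have [_] := Hf j; rewrite fi fj => /WW' + /WW'/W's.
move=> /[swap] /W'V/[apply]; rewrite invgM !invgK invgM -!mulgA.
by rewrite mulVKg mulKg.
Qed.

(** Pairs of a coset and a number embed in [F], so countably many objects per coset cost no more
    than [F]. *)
Lemma coset_nat_injection (F : set G) :
  (forall g, infinite_set (F `&` coset g)) ->
  exists e : set G -> nat -> G, (forall g n, F (e (coset g) n)) /\
    forall g n h k, e (coset g) n = e (coset h) k -> coset g = coset h /\ n = k.
Proof.
move=> iF.
have /choice[e He] (A : set G) : exists e : nat -> G, infinite_set (F `&` A) ->
    (forall n, (F `&` A) (e n)) /\ injective e.
  case: (pselect (infinite_set (F `&` A))) => [/infiniteP iA|nA]; last first.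
    by exists (fun _ => 1).
  have [e [eA ei]] := card_le_injection 1 iA.
  by exists e => _; split => [n|n k /ei]; [exact: eA|exact].
exists e; split => [g n|g n h k]; first by have [/(_ n)[]] := He _ (iF g).
have [/(_ n)[_ gn] ge] := He _ (iF g); have [/(_ k)[_ hk] _] := He _ (iF h).
move=> ee; have gh : coset g = coset h.
  by rewrite (cosetE gn) ee -(cosetE hk).
by split => //; apply: ge; rewrite ee gh.
Qed.

Let representative : exists r : set G -> G,
  forall g, k_core C ((r (coset g))^-1 * g).
Proof.
have /choice[r Hr] (A : set G) : exists r, A !=set0 -> A r.
  by case: (pselect (A !=set0)) => [[r Ar]|nA]; [exists r|exists 1].
exists r => g; suff : coset (r (coset g)) g by [].
have <- : coset g = coset (r (coset g)); last exact: coset_refl.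
by apply: cosetE; apply: Hr; exists g; exact: coset_refl.
Qed.

(** The compact sets [r * C n], with one representative [r] per coset, determine the topology
    because every convergent sequence has a tail in one of them. They are indexed by pairs of a
    coset and a number. *)
Lemma k_ness_le_boundedness (K L : Type) :
  boundedness_index G K -> k_ness G L -> [set: L] #<= [set: K].
Proof.
move=> [ibK _] [_ leL]; have [W [oW W1 FW]] := infinite_translates.
have [F FK GF] := ibK W oW (ex_intro _ 1 W1).
have [e [eF ei]] := coset_nat_injection (FW F GF).
have [r Hr] := representative.
pose M (p : set G * nat) : set G := [set r p.1 * c | c in C p.2].
pose I : set (set G * nat) := [set p | exists g, p.1 = coset g].
have HM z : exists2 n, C n ((r (coset z))^-1 * z) & forall k, (n <= k)%N ->
    M (coset z, k) z.
  have [n Cn] := Hr z.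
  exists n => // k nk; exists ((r (coset z))^-1 * z); last by rewrite mulVKg.
  exact: k_omega_le nk _ Cn.
apply: (card_le_trans (leL (M @` I) _)); last first.
  rewrite (card_le_eql (card_setT _)); apply: card_le_trans (card_image_le _ _) _.
  apply: card_le_trans FK; apply: (injection_card_le (f := fun p => e p.1 p.2)).
    by move=> [A n] [g /= ->]; exact: eF.
  by move=> [A n] [B k] [g /= ->] [h /= ->] /ei[-> ->].
exists (M @` I); last by rewrite card_eq_sym card_setT.
have compactM p : compact (M p).
  apply: (@continuous_compact _ _ (fun c => r p.1 * c)); last exact: compactC.
  apply: continuous_subspaceT => c.
  apply: (@continuous_comp _ _ _ (fun z : G => (r p.1, z))
    (fun p : G * G => p.1 * p.2)); last exact: mulg_continuous.
  by apply: cvg_pair => /=; [exact: cvg_cst|exact: cvg_id].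
have closedM p : closed (M p).
  exact: compact_closed (accessible_group_hausdorff T1G) (compactM p).
split.
- by move=> _ [p _ <-].
- apply/seteqP; split => // z _; have [n _ /(_ n (leqnn n)) Mz] := HM z.
  by exists (M (coset z, n)) => //; exists (coset z, n) => //; exists z.
move=> A; split => [cA D _|cA].
  by apply/closed_subspaceP; exists A => //; rewrite -setIA setIid.
apply: sequential_closed => // z u uA uz.
have [n [N [Cz Cu]]] := k_core_cvg kC (Hr z) (cvg_seqMl uz).
have : closed (A `&` M (coset z, n) : set (subspace (M (coset z, n)))).
  by apply: cA; exists (coset z, n) => //; exists z.
move=> /closed_subspaceP[B cB BA].
have MB : closed (A `&` M (coset z, n)).
  have -> : A `&` M (coset z, n) = B `&` M (coset z, n) by rewrite BA -setIA setIid.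
  exact: closedI.
suff [] : (A `&` M (coset z, n)) z by [].
have ai : strictly_increasing (addn N) by move=> k; rewrite ltn_add2l.
apply: (cvg_seq_in_closed MB _ (cvg_subsequence ai uz)) => k /=.
split=> //; exists ((r (coset z))^-1 * u (N + k)%N); last by rewrite mulVKg.
by apply: Cu; rewrite leq_addr.
Qed.

(** A point is determined by its coset and by the number of its quotient by the representative in an
    enumeration of the core. *)
Lemma countable_core_card_le (K : Type) :
  boundedness_index G K -> countable (k_core C) -> [set: G] #<= [set: K].
Proof.
move=> [ibK _] /countable_injP[q qi]; have [W [oW W1 FW]] := infinite_translates.
have [F FK GF] := ibK W oW (ex_intro _ 1 W1).
have [e [eF ei]] := coset_nat_injection (FW F GF).
have [r Hr] := representative.
have rH z : (r (coset z))^-1 * z \in k_core C.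
  by rewrite inE.
apply: card_le_trans FK.
apply: (injection_card_le
  (f := fun z => e (coset z) (q ((r (coset z))^-1 * z)))) => // z y _ _ /ei[zy].
by move=> /(qi _ _ (rH z) (rH y)); rewrite zy => /(congr1 (fun t => r (coset y) * t));
  rewrite !mulVKg.
Qed.

End Translates.

End KOmegaConsequences.

(** * Uncountable compact sets *)

Section CantorScheme.
Variable G : topologicalGroupType.
Local Open Scope group_scope.
Implicit Types (x y z : G) (A B D V W : set G).
Hypothesis T1G : accessible_space G.
Hypothesis seqG : sequential_space G.
Variable N : nat -> set G.
Hypothesis netN : unit_network N.
Variable K : set G.
Hypothesis cK : sequentially_compact K.

(* Two points all of whose neighborhoods are uncountable can be separated; one
   such point [x] cannot be alone, as [D] without a neighborhood of [x] would be
   countable. *)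
Lemma uncountable_closed_split D : D `<=` K -> closed D -> ~ countable D ->
  exists D0 D1, [/\ D0 `<=` D /\ D1 `<=` D, closed D0 /\ closed D1,
    ~ countable D0 /\ ~ countable D1 & D0 `&` D1 = set0].
Proof.
move=> DK cD uD.
have [U [oU Us bU]] := countable_local_base_quotient T1G seqG netN cK.
pose small W := countable (W `&` D).
have smallU A B : small A -> small B -> small (A `|` B).
  move=> sA sB; rewrite /small setIUl.
  rewrite -bigcup2E; apply: bigcup_countable => // i _.
  by case: i => [|[|i]] //=; rewrite /bigcup2 /=; exact: countable0.
have smallS A B : A `<=` B -> small B -> small A.
  by move=> AB; apply: sub_countable; apply: subset_card_le => z [/AB].
have small_compact A : (forall x, K x -> exists2 W, nbhs x W & small (W `&` A)) ->
    small (K `&` A).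
  move=> H; apply: (sequentially_compact_induction cK oU Us bU
    (P := fun B => small (B `&` A))).
  - by rewrite set0I /small set0I; exact: countable0.
  - by move=> B B' sB sB'; rewrite setIUl; exact: smallU.
  - by move=> B B' BB; apply: smallS => z [/BB].
  move=> x /H[W nW sW]; exists W => //; apply: smallS sW => z [[]].
  by [].
have [x Kx ux] : exists2 x, K x & forall W, nbhs x W -> ~ small W.
  apply: contrapT => nx; apply: uD; apply: sub_countable (_ : small (K `&` setT)).
    by apply: subset_card_le => z Dz; split => //; split => //; exact: DK.
  apply: small_compact => x Kx; apply: contrapT => nW; apply: nx; exists x => // W nW' sW.
  by apply: nW; exists W => //; rewrite setIT.
have [y [Ky xy uy]] : exists y, [/\ K y, x <> y & forall W, nbhs y W -> ~ small W].
  apply: contrapT => ny.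
  have sn n : small (K `&` ~` [set z | U n (x^-1 * z)]).
    apply: small_compact => y Ky; case: (pselect (x = y)) => [<-|xy].
      exists [set z | U n (x^-1 * z)].
        apply/nbhs_translate; rewrite /= (_ : [set _ | _] = U n).
          by apply: open_nbhs_nbhs; exact: oU.
        by apply/seteqP; split => z /=; rewrite mulKg.
      by rewrite setICr /small set0I; exact: countable0.
    apply: contrapT => nW; apply: ny; exists y; split => // W nW' sW; apply: nW.
    by exists W => //; apply: smallS sW => z [].
  apply: uD; apply: (@sub_countable _ _ _ ([set x] `|`
      \bigcup_(n in [set: nat]) (K `&` ~` [set z | U n (x^-1 * z)] `&` D))).
    apply: subset_card_le => z Dz; case: (pselect (z = x)) => [->|zx]; first by left.
    right; have [V nV nVz] : exists2 V, nbhs 1 V & ~ V (x^-1 * z).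
      apply: (nbhs_unit_avoid T1G) => xz; apply: zx.
      by rewrite -[z](mulVKg x) xz mulg1.
    have [n UV] := bU V nV; exists n => //; split => //; split; first exact: DK.
    move=> /= Uz; apply: nVz; apply: UV; split => //.
    by exists x => //; exists z => //; exact: DK.
  rewrite -bigcup2E; apply: bigcup_countable => // i _.
  case: i => [|[|i]]; rewrite /bigcup2 /=; last exact: countable0.
    exact: countable1.
  by apply: bigcup_countable => // n _; exact: sn.
have nx : nbhs x (~` [set y]).
  apply: open_nbhs_nbhs; split => //.
  by apply: closed_openC; exact: accessible_closed_set1.
have [W nW Wy] := nbhs_closure nx.
have ny : nbhs y (~` closure W).
  apply: open_nbhs_nbhs; split; last by move=> /Wy; apply.
  by apply: closed_openC; exact: closed_closure.
have [V nV VW] := nbhs_closure ny.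
exists (closure W `&` D), (closure V `&` D); split.
- by split => z [].
- by split; apply: closedI => //; exact: closed_closure.
- split; [apply: (ux (closure W))|apply: (uy (closure V))];
    by apply: filterS; first exact: subset_closure.
by rewrite -subset0 => z [[Wz _] [/VW]].
Qed.

(** A Cantor scheme of uncountable closed subsets of [K]. Sequential compactness gives a point
    common to all sets of a branch, and different branches separate into disjoint sets. *)
Lemma uncountable_compact_card : ~ countable K -> [set: set nat] #<= [set: G].
Proof.
move=> uK; have cloK : closed K.
  by apply: sequentially_compact_closed => //; exact: accessible_group_hausdorff.
have /choice[s Hs] (D : set G) : exists E : bool -> set G,
    D `<=` K -> closed D -> ~ countable D ->
    (forall b, [/\ E b `<=` D, closed (E b) & ~ countable (E b)]) /\
    E true `&` E false = set0.
  case: (pselect [/\ D `<=` K, closed D & ~ countable D]) => [[DK cD uD]|nD].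
    have [D0 [D1 [[D0s D1s] [cD0 cD1] [uD0 uD1] D01]]] :=
      uncountable_closed_split DK cD uD.
    by exists (fun b => if b then D0 else D1) => _ _ _; split => // -[].
  by exists (fun _ => D) => DK cD uD; exfalso; apply: nD.
pose D := fix D (w : seq bool) := if w is b :: w' then s (D w') b else K.
have HD w : [/\ D w `<=` K, closed (D w) & ~ countable (D w)].
  elim: w => [|b w [DK cD uD]]; first by split.
  have [/(_ b)[sD cs us] _] := Hs _ DK cD uD.
  by split => //; exact: subset_trans sD DK.
have Dcons b w : D (b :: w) `<=` D w.
  by have [DK cD uD] := HD w; have [/(_ b)[]] := Hs _ DK cD uD.
have Ddisj w w' : size w = size w' -> w <> w' -> D w `&` D w' = set0.
  elim: w w' => [[]//|b w IH [//|b' w'] [ww'] bw].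
  case: (pselect (w = w')) => [ww|/(IH _ ww') DD]; last first.
    by rewrite -subset0 -DD => z [/Dcons ? /Dcons].
  subst w'; have [DK cD uD] := HD w; have [_ sD] := Hs _ DK cD uD.
  by case: b b' bw => [] [] bw //=; rewrite setIC.
(* The latest bit comes first, as in the recursion of [D]. *)
pose path (A : set nat) := fix path n :=
  if n is n'.+1 then `[< A n' >] :: path n' else [::].
have sz (A : set nat) n : size (path A n) = n by elim: n => //= n ->.
have Ple (A : set nat) n k : (n <= k)%N -> D (path A k) `<=` D (path A n).
  elim: k => [|k IH]; first by rewrite leqn0 => /eqP->.
  rewrite leq_eqVlt => /orP[/eqP->//|/IH nk].
  by apply: subset_trans nk; exact: Dcons.
have /choice[f Hf] (A : set nat) : exists z, forall n, D (path A n) z.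
  have /choice[u Hu] n : exists z, D (path A n) z.
    apply: contrapT => nz; have [_ _] := HD (path A n); apply.
    rewrite (_ : D _ = set0); first exact: countable0.
    by rewrite -subset0 => z Dz; apply: nz; exists z.
  have uKn n : K (u n) by have [DK _ _] := HD (path A n); exact: DK.
  have [g [gi [z _ gz]]] := cK uKn.
  exists z => n; have [_ cD _] := HD (path A n).
  have ai : strictly_increasing (addn n) by move=> k; rewrite ltn_add2l.
  apply: (cvg_seq_in_closed cD _ (cvg_subsequence ai gz)) => k /=.
  apply: (Ple _ _ (g (n + k)%N)); last exact: Hu.
  exact: leq_trans (leq_addr k n) (strictly_increasing_ge _ gi).
apply: (injection_card_le (f := f)) => // A B _ _ fAB.
have pAB n : path A n = path B n.
  apply: contrapT => ne; have : (D (path A n) `&` D (path B n)) (f A).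
    by split; [exact: Hf|rewrite fAB; exact: Hf].
  by rewrite Ddisj// !sz.
apply/seteqP; split => n Xn; apply/asboolP; have [e _] := pAB n.+1.
  by rewrite -e; exact/asboolP.
by rewrite e; exact/asboolP.
Qed.

End CantorScheme.

(** * Sequential order *)

Lemma ole_refl a : ole a a.
Proof. by elim: a => T f IH i; exists i; exact: IH. Qed.

Lemma ole_or_olt a b : ole a b \/ olt b a.
Proof.
elim: a b => T f IH [U g].
case: (pselect (ole (osup f) (osup g))) => [?|/=]; first by left.
move=> /existsNP[i /forallNP fg]; right; exists i.
by case: (f i) (IH i) fg => V h IHi fg j; have [/fg|] := IHi (g j).
Qed.

Lemma olt_ole a b : olt a b -> ole a b.
Proof.
elim: a b => T f IH [U g] /= [j]; case E : (g j) => [V h] fh i; exists j.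
rewrite E; have [k fk] := fh i; apply: IH; exists k; exact: fk.
Qed.

Lemma olt_ole_trans b a c : olt a b -> ole b c -> olt a c.
Proof.
case: b c => [U g] [V h] /= [j aj] gh; have [k gk] := gh j.
by exists k; exact: ole_trans gk.
Qed.

Lemma ole_finite_max (f : nat -> ord) n :
  exists k, forall i, (i <= n)%N -> ole (f i) (f k).
Proof.
elim: n => [|n [k Hk]].
  by exists 0 => i; rewrite leqn0 => /eqP->; exact: ole_refl.
have [kn|nk] := ole_or_olt (f k) (f n.+1).
  exists n.+1 => i; rewrite leq_eqVlt => /orP[/eqP->|/Hk ik].
    exact: ole_refl.
  exact: ole_trans kn.
exists k => i; rewrite leq_eqVlt => /orP[/eqP->|/Hk//].
exact: olt_ole.
Qed.

Section SeqClosureIter.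
Variable X : topologicalType.
Implicit Types A : set X.

Lemma seq_closure_iter_closure A a : seq_closure_iter A a `<=` closure A.
Proof.
elim/(well_founded_ind olt_wf): a => a IH x; rewrite seq_closure_iterE => /=.
have H B : B `<=` closure A -> seq_closure B x -> closure A x.
  move=> BA [u uB ux]; apply: (cvg_seq_in_closed (@closed_closure _ A) _ ux) => n.
  exact: BA.
by move=> [[_]|[_ [b [ba _]]]]; apply: H; [exact: subset_closure|exact: IH].
Qed.

Lemma sub_seq_closure A : A `<=` seq_closure A.
Proof. by move=> x Ax; exists (fun _ => x) => //; exact: cvg_seq_cst. Qed.

Lemma not_ole_two_one : ~ ole otwo oone.
Proof. by move=> /(_ tt)[[]] /(_ tt)[[]]. Qed.

Lemma seq_closure_iter_le A a b : ole a b ->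
  seq_closure_iter A a `<=` seq_closure_iter A b.
Proof.
move=> ab x; rewrite !seq_closure_iterE => -[[a2 Ax]|[a2 [c [ca c1 Ax]]]].
  case: (pselect (ole otwo b)) => b2; last by left.
  right; split => //; exists oone; split.
  - by case: b b2 {ab} => [U g] /= /(_ tt).
  - exact: ole_refl.
  have [u uA ux] := Ax; exists u => // n; rewrite seq_closure_iterE; left.
  by split; [exact: not_ole_two_one|exact: sub_seq_closure].
right; split; first exact: (ole_trans a2 ab).
by exists c; split => //; exact: olt_ole_trans ab.
Qed.

Lemma stable_seq_closure_iter A a : ole oone a -> seq_order_stable X a ->
  A `<=` seq_closure_iter A a /\
  seq_closure (seq_closure_iter A a) `<=` seq_closure_iter A a.
Proof.
move=> a1 st; split; last first.
  move=> x Ax; rewrite -st seq_closure_iterE; right; split.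
    by move=> [] /=; exists tt.
  by exists a; split => //; exists tt; exact: ole_refl.
move=> x Ax; apply: (seq_closure_iter_le a1); rewrite seq_closure_iterE; left.
by split; [exact: not_ole_two_one|exact: sub_seq_closure].
Qed.

End SeqClosureIter.

Section SequentialOrder.
Variable G : topologicalGroupType.
Local Open Scope group_scope.
Implicit Types (z : G) (v : nat -> G) (A B D V W : set G).
Hypothesis T1G : accessible_space G.
Hypothesis seqG : sequential_space G.
Variable C : nat -> set G.
Hypothesis kC : k_omega C.
Variable x : nat -> nat -> G.
Hypothesis fanx : is_fan x.
Hypothesis x_inj : forall n m n' m', x n m = x n' m' -> n = n' /\ m = m'.

(** Iterated sequential closures are local and translation invariant: a sequence with limit in the
    open [V] has a tail in [V]. *)
Lemma seq_closure_iter_transfer A B V (y : G) : open V ->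
  (forall z, A z -> V z -> B (y^-1 * z)) ->
  forall a z, seq_closure_iter A a z -> V z -> seq_closure_iter B a (y^-1 * z).
Proof.
move=> oV; have H (A' B' : set G) : (forall z, A' z -> V z -> B' (y^-1 * z)) ->
    forall z, seq_closure A' z -> V z -> seq_closure B' (y^-1 * z).
  move=> AB z [u uA uz] Vz.
  have /cvg_seqP/(_ V (open_nbhs_nbhs (conj oV Vz)))[M MV] := uz.
  have ai : strictly_increasing (addn M) by move=> k; rewrite ltn_add2l.
  exists (fun k => y^-1 * u (M + k)%N); last exact: cvg_seqMl (cvg_subsequence ai uz).
  by move=> k; apply: AB => //; apply: MV; exact: leq_addr.
move=> AB; elim/(well_founded_ind olt_wf) => a IH z; rewrite !seq_closure_iterE /=.
move=> [[a2 Az]|[a2 [b [ba b1 Az]]]] Vz; first by left; split => //; exact: H Az Vz.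
by right; split => //; exists b; split => //; apply: H Az Vz; exact: IH.
Qed.

(** The clause on [C j] isolates [1] there. With [j] growing from piece to piece, translated pieces
    have only their base points in any given [C i], up to finitely many pieces. *)
Definition unit_cluster_set j W A := [/\ closure A `<=` W `&` k_core C,
  forall z, closure A z -> C j z -> z = 1 & closure A 1].

(* [A] is the union of the sets [y n * B n], where [y n] runs through an arm of
   the fan outside [C j] and [B n] is good for so large a compact set that these
   pieces accumulate only at [1]. *)
Lemma glue_unit_cluster_sets (P : nat -> set G -> Prop) :
  (forall n j W, nbhs 1 W -> exists2 A, unit_cluster_set j W A & P n A) ->
  forall j W, nbhs 1 W -> exists A (y : nat -> G) (B : nat -> set G),
    [/\ unit_cluster_set j W A /\ ~ A 1, forall n, P n (B n),
      forall v, (forall k, closure A (v k) /\ v k <> 1) -> v @ \oo --> (1 : G) ->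
        forall m, exists2 n, (m <= n)%N & exists k, v k = y n &
      forall n, exists V, [/\ open V, V (y n) &
        forall z, A z -> V z -> B n ((y n)^-1 * z)]].
Proof.
move=> HP j W' /nbhs_open_unit[W [oW W1 WW']]; case: (kC) => cC C1 CV CM _.
(* If every arm met [C j], a transversal would lie in this sequentially compact set. *)
have [a Ca] : exists a, forall m, ~ C j (x a m).
  apply: contrapT => H; have /choice[m Hm] n : exists m, C j (x n m).
    by apply: contrapT => nm; apply: H; exists n => m Cm; apply: nm; exists m.
  by have [n] := sequentially_compact_no (cC j) (fanx.2 m); apply.
have [p [M [_ Cp]]] := k_core_cvg kC (k_core1 kC) (fanx.1 a).
have /cvg_seqP/(_ W (open_nbhs_nbhs (conj oW W1)))[M' MW] := fanx.1 a.
pose y n := x a (maxn M M' + n)%N.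
have yC n : ~ C j (y n) by exact: Ca.
have yp n : C p (y n).
  by apply: Cp; apply: leq_trans (leq_addr _ _); exact: leq_maxl.
have yW n : W (y n).
  by apply: MW; apply: leq_trans (leq_addr _ _); exact: leq_maxr.
have y1 : y @ \oo --> (1 : G).
  apply: (@cvg_subsequence _ (x a) 1 (addn (maxn M M'))); last exact: fanx.1.
  by move=> k; rewrite ltn_add2l.
have y_neq1 n : 1 <> y n by move=> e; apply: (yC n); rewrite -e.
have y_inj n m : y n = y m -> n = m by move=> /x_inj[_ /addnI].
(* [C (q n)] contains every [y n], contains [C j], and eventually contains any given [C i]. For [z]
   in it, [(y n)^-1 * z] lies in [C (q n).+1], hence the successor below. *)
pose q n := maxn (maxn p j) n.
have /choice[B HB] n : exists B,
    unit_cluster_set (q n).+1 [set z | W (y n * z)] B /\ P n B.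
  have [|B] := HP n (q n).+1 [set z | W (y n * z)]; last by exists B.
  by apply: nbhs_mull; rewrite mulg1; exact: open_nbhs_nbhs.
pose D n := [set z | closure (B n) ((y n)^-1 * z)].
have closedD n : closed (D n).
  apply: sequential_closed => // z u uD uz.
  exact: (cvg_seq_in_closed (@closed_closure _ _) uD (cvg_seqMl uz)).
have Dy n : D n (y n) by rewrite /D /= mulVg; have [[]] := HB n.
have DW n z : D n z -> W z /\ k_core C z.
  have [[BW _ _] _] := HB n; move=> /BW[/=]; rewrite mulVKg => Wz.
  by rewrite (k_core_mull kC _ (k_coreV kC (ex_intro _ p (yp n)))).
have DC n i z : (i <= q n)%N -> D n z -> C i z -> z = y n.
  have [[_ B1 _] _] := HB n; move=> iq Dz Cz; rewrite -[z](mulVKg (y n)).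
  rewrite (B1 _ Dz) ?mulg1//; apply: CM; last exact: k_omega_le iq _ Cz.
  apply: CV; apply: (k_omega_le kC _ (yp n)).
  by rewrite /q -maxnA leq_maxl.
have D1 n : ~ D n 1.
  by move=> Dn; apply: (y_neq1 n); exact: (DC n 0 1 (leq0n _) Dn (C1 0)).
have Dym n m : D n (y m) -> n = m.
  move=> Dm; apply/esym/y_inj; apply: (DC n p) => //.
  by rewrite /q -maxnA leq_maxl.
pose E (I : set nat) := [set z | z = 1 \/ exists2 n, I n & D n z].
have closedE I : closed (E I).
  apply: sequential_closed => // z u uE uz.
  case: (pselect (z = 1)) => [->|z1]; first by left.
  have [L HL] := cvg_seq_neq T1G z1 uz.
  have ai : strictly_increasing (addn L) by move=> k; rewrite ltn_add2l.
  have {}uz := cvg_subsequence ai uz.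
  have /choice[n Hn] k : exists n, I n /\ D n (u (L + k)%N).
    by have [/HL|[n In Dn]] := uE (L + k)%N; [rewrite leq_addr => /(_ isT)|exists n].
  have [i [L' [_ Ci]]] := k_core_cvg_seq seqG kC (fun k => (DW _ _ (Hn k).2).2) uz.
  have [[e [f fi nf]]|[f fi nfi]] := nat_subsequence n.
    right; exists e; first by rewrite -(nf 0); have [] := Hn (f 0).
    apply: (cvg_seq_in_closed (closedD e) _ (cvg_subsequence fi uz)) => k.
    by rewrite -(nf k) /=; have [] := Hn (f k).
  (* The terms stay in one [C i], which meets the piece [D n] at most in [y n] once [n] is at least
     [i]. So they eventually agree with a subsequence of [y], which tends to [1]. *)
  exfalso; apply: z1; apply: (cvg_seq_unique T1G (cvg_subsequence fi uz)).
  apply: (@cvg_seq_eventually _ (y \o (n \o f)) _ _ (maxn i L')); last first.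
    exact: cvg_subsequence nfi y1.
  move=> k; rewrite geq_max => /andP[ik Lk] /=.
  apply/esym/(DC _ i); last by apply: Ci; apply: leq_trans Lk (strictly_increasing_ge _ fi).
    apply: leq_trans ik (leq_trans (strictly_increasing_ge _ nfi) _).
    exact: leq_maxr.
  by have [] := Hn (f k).
pose A := [set z | exists n, B n ((y n)^-1 * z)].
have AE : closure A `<=` E setT.
  rewrite (closure_id (E setT)).1 //; apply: closureS => z [n Bz].
  by right; exists n => //; exact: subset_closure.
exists A, y, B; split => [|n|v vA v1 m|n]; last 1 first.
- exists (~` E [set m | m <> n]); split; first exact: closed_openC.
    by move=> [/esym/y_neq1|[m mn /Dym]].
  move=> z [m Bz] nE; suff <- : m = n by [].
  apply: contrapT => mn; apply: nE; right; exists m => //.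
  exact: subset_closure.
- split; last by move=> [n Bn]; apply: (D1 n); exact: subset_closure.
  split.
  + move=> z /AE[->|[n _ /DW[/WW' ? ?]]] //.
    by split; [exact: WW'|exact: k_core1].
  + by move=> z /AE[//|[n _ Dz] Cz]; case: (yC n); rewrite -(DC n j z)// /q leq_max leq_maxr.
  apply: (cvg_seq_in_closed (@closed_closure _ A) _ y1) => n U /nbhs_translate nU.
  have [[_ _ /(_ _ nU)[b [Bb Ub]]] _] := HB n.
  by exists (y n * b); split => //; exists n; rewrite mulKg.
- by have [] := HB n.
have /choice[n Hn] k : exists n, D n (v k).
  by have [/AE[//|[n _ Dn]] _] := vA k; exists n.
have [i [L [_ Ci]]] := k_core_cvg kC (k_core1 kC) v1.
have [[e [f fi nf]]|[f fi nfi]] := nat_subsequence n.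
  exfalso; apply: (D1 e).
  apply: (cvg_seq_in_closed (closedD e) _ (cvg_subsequence fi v1)) => k.
  by rewrite -(nf k) /=; exact: Hn.
pose k := maxn (maxn i L) m; exists (n (f k)).
  exact: leq_trans (leq_maxr _ _) (strictly_increasing_ge _ nfi).
exists (f k); apply: (DC _ i) => //; last first.
  apply: Ci; apply: leq_trans (strictly_increasing_ge _ fi).
  by rewrite /k -maxnA maxnCA leq_maxl.
apply: leq_trans (leq_maxr _ _).
apply: leq_trans (strictly_increasing_ge k nfi); by rewrite /k -maxnA leq_maxl.
Qed.

(** A sequence reaching [1] from an earlier iterate of [A] that omits [1] passes through [y n] for
    arbitrarily large [n]. Near [y n] the set [A] looks like [B n] near [1], so [B n] would reach
    [1] at that earlier stage. *)
Lemma glued_not_seq_closure_iter A (y : nat -> G) (B : nat -> set G) a :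
  ~ A 1 -> (forall n, ~ B n 1) ->
  (forall v, (forall k, closure A (v k) /\ v k <> 1) -> v @ \oo --> (1 : G) ->
        forall m, exists2 n, (m <= n)%N & exists k, v k = y n) ->
  (forall n, exists V, [/\ open V, V (y n) &
        forall z, A z -> V z -> B n ((y n)^-1 * z)]) ->
  (forall c, olt c a -> exists m, forall n, (m <= n)%N ->
     ~ seq_closure_iter (B n) c 1) ->
  ~ seq_closure_iter A a 1.
Proof.
move=> A1 B1 Ay AB; elim/(well_founded_ind olt_wf): a => a IH Ha.
rewrite seq_closure_iterE /= => -[[_ [v vA v1]]|[_ [b [ba _ [v vA v1]]]]].
  have [|n _ [k vy]] := Ay v _ v1 0.
    by move=> k; split; [exact: subset_closure|move=> vk; apply: A1; rewrite -vk].
  have [V [_ Vy /(_ _ (vA k))]] := AB n; rewrite vy mulVg => /(_ Vy); exact: B1.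
have nb : ~ seq_closure_iter A b 1.
  apply: IH => // c cb; apply: Ha.
  exact: olt_ole_trans cb (olt_ole ba).
have [m Hm] := Ha b ba; have [|n mn [k vy]] := Ay v _ v1 m.
  move=> k; split; first exact: seq_closure_iter_closure (vA k).
  by move=> vk; apply: nb; rewrite -vk.
have [V [oV Vy VAB]] := AB n; apply: (Hm n mn).
rewrite -(mulVg (y n)); apply: (seq_closure_iter_transfer oV VAB) => //.
by rewrite -vy.
Qed.

(** At [Csup f] the piece [B n] is taken to survive the stages [f 0], ..., [f n], the largest of
    which is one of them. Any stage below the supremum is then survived by all but finitely many
    pieces. *)
Lemma unit_cluster_set_iter (c : countable_ord) j W : nbhs 1 W ->
  exists2 A, unit_cluster_set j W A &
    ~ A 1 /\ ~ seq_closure_iter A (ord_of_countable c) 1.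
Proof.
(* Gluing translates of the singleton of [1] gives cluster sets that omit [1], the start of the
   induction. *)
have step0 j' W' : nbhs 1 W' -> exists2 A, unit_cluster_set j' W' A & ~ A 1.
  move=> nW'; have H n i V : nbhs 1 V ->
      exists2 A, unit_cluster_set i V A & (fun (_ : nat) (_ : set G) => True) n A.
    move=> nV; exists [set 1] => //.
    have cl1 : closure [set (1 : G)] = [set 1].
      by apply/esym/closure_id; exact: accessible_closed_set1.
    rewrite /unit_cluster_set cl1; split => //.
    by move=> z ->; split; [exact: nbhs_singleton|exact: k_core1].
  have [A [y [B [[? ?] _ _ _]]]] := glue_unit_cluster_sets H j' nW'.
  by exists A.
elim: c j W => [|f IH] j W nW.
  have [A [y [B [[gA A1] B1 Ay AB]]]] :=
    glue_unit_cluster_sets (P := fun _ B => ~ B 1) (fun _ => step0) j nW.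
  exists A => //; split => //.
  by apply: (glued_not_seq_closure_iter A1 B1 Ay AB) => c [[]].
have H n i V : nbhs 1 V -> exists2 A, unit_cluster_set i V A &
    (fun n B => ~ B 1 /\ forall k, (k <= n)%N ->
      ~ seq_closure_iter B (ord_of_countable (f k)) 1) n A.
  move=> nV; have [k Hk] := ole_finite_max (fun k => ord_of_countable (f k)) n.
  have [A gA [A1 Ak]] := IH k i V nV; exists A => //; split => // l ln Al.
  by apply: Ak; apply: seq_closure_iter_le Al; exact: Hk.
have [A [y [B [[gA A1] HB Ay AB]]]] := glue_unit_cluster_sets H j nW.
exists A => //; split => //.
apply: (glued_not_seq_closure_iter A1 (fun n => (HB n).1) Ay AB) => c [k ck].
exists k => n kn; have [_ /(_ k kn) nBk] := HB n.
by move=> Bc; apply: nBk; exact: seq_closure_iter_le Bc.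
Qed.

(** In a sequential space a stable iterate is closed, so it contains the closure; for the set built
    from a countable ordinal not below [a], the point [1] tells the two apart. *)
Lemma fan_seq_order : ~ exists2 a, is_seq_order G a & olt a omega1.
Proof.
move=> [a [a1 st _] [c ac]].
have [A [_ _ A1] [_ nA]] := @unit_cluster_set_iter c 0 setT filterT.
apply: nA; apply: (seq_closure_iter_le ac).
have [sA cA] := stable_seq_closure_iter A a1 st.
have /closure_id -> : closed (seq_closure_iter A a) := seqG cA.
exact: (closureS sA).
Qed.

End SequentialOrder.

(** * The closed copy of the sequential fan *)

Section ArensPoints.
Variable R : realType.
Local Open Scope ring_scope.

(** Indices start at [0] here, while arms and positions of the Arens space are numbered from [1]. *)
Definition arens_height (n m : nat) : R := (n.+1 * m.+1)%N%:R^-1.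

Definition arens_leaf (n m : nat) : R * R := (n.+1%:R^-1, arens_height n m).

Lemma arens_height_gt0 n m : 0 < arens_height n m.
Proof. by rewrite invr_gt0 ltr0n muln_gt0. Qed.

Lemma ltr_arens_height n m m' :
  (arens_height n m < arens_height n m') = (m' < m)%N.
Proof. by rewrite ltf_pV2 ?posrE ?ltr0n ?muln_gt0// ltr_nat ltn_pmul2l. Qed.

Lemma arens_leaf_inj n m n' m' :
  arens_leaf n m = arens_leaf n' m' -> n = n' /\ m = m'.
Proof.
move=> [/invr_inj/eqP]; rewrite eqr_nat => /eqP [<-] /invr_inj/eqP.
by rewrite eqr_nat eqn_pmul2l// => /eqP[].
Qed.

Lemma arens_seqSP n p : @arens_seq R n.+1 p <->
  p = (n.+1%:R^-1, 0) \/ exists m, p = arens_leaf n m.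
Proof.
rewrite /arens_seq /=; split => -[->|]; try by left.
  by move=> [[//|m] _ ->]; right; exists m.
by move=> [m ->]; right; exists m.+1.
Qed.

Lemma arens_leaf_seq n m : @arens_seq R n.+1 (arens_leaf n m).
Proof. by apply/arens_seqSP; right; exists m. Qed.

Lemma arens_leaf_set n m : arens_leaf n m \in @arens_set R.
Proof. by rewrite inE; exists n.+1 => //; exact: arens_leaf_seq. Qed.

Lemma arens_leaf_not_root n m : ~ @arens_seq R 0 (arens_leaf n m).
Proof.
rewrite /arens_seq /= => -[[_ h0]|[k _ [_ h0]]];
  by have := arens_height_gt0 n m; rewrite h0 ltxx.
Qed.

Lemma arens_node_root n : @arens_seq R 0 (n.+1%:R^-1, 0).
Proof. by right; exists n.+1. Qed.

Lemma arens_setP p : @arens_set R p ->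
  @arens_seq R 0 p \/ exists n m, p = arens_leaf n m.
Proof.
move=> [[|n] _]; first by left.
move=> /arens_seqSP[->|[m ->]]; first by left; exact: arens_node_root.
by right; exists n, m.
Qed.

Lemma open_height_lt (c : R) : open [set p : R * R | p.2 < c].
Proof.
apply: (@open_comp _ _ (fun p : R * R => p.2) [set x | x < c]).
  by move=> p _; exact: cvg_snd.
exact: open_lt.
Qed.

Lemma open_height_gt (c : R) : open [set p : R * R | c < p.2].
Proof.
apply: (@open_comp _ _ (fun p : R * R => p.2) [set x | c < x]).
  by move=> p _; exact: cvg_snd.
exact: open_gt.
Qed.

Lemma arens_leaf_isolated n m : exists V : set (R * R),
  [/\ open V, V (arens_leaf n m) &
    forall p, @arens_seq R n.+1 p -> V p -> p = arens_leaf n m].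
Proof.
have [V' [oV' V'm V'lt]] : exists V : set (R * R), [/\ open V,
    V (arens_leaf n m) & forall m', V (arens_leaf n m') -> (m <= m')%N].
  case: m => [|m]; first by exists setT; split => //; exact: openT.
  exists [set p | p.2 < arens_height n m]; split.
  - exact: open_height_lt.
  - by rewrite /= ltr_arens_height.
  by move=> m'; rewrite /= ltr_arens_height.
exists (V' `&` [set p | arens_height n m.+1 < p.2]); split.
- by apply: openI => //; exact: open_height_gt.
- by split => //=; rewrite ltr_arens_height.
move=> p /arens_seqSP[->|[m' ->]] [Vp] /=.
  by move/(lt_trans (arens_height_gt0 _ _)); rewrite ltxx.
rewrite ltr_arens_height ltnS => m'm; congr arens_leaf.
by apply/eqP; rewrite eqn_leq m'm V'lt.
Qed.

Lemma arens_leaf_cvg n (V : set (R * R)) : open V -> V (n.+1%:R^-1, 0) ->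
  exists M, forall m, (M <= m)%N -> V (arens_leaf n m).
Proof.
move=> oV Vn; have /nbhs_ballP[e /= e0 eV] := open_nbhs_nbhs (conj oV Vn).
have [M _ HM] := near_infty_natSinv_lt (PosNum e0).
exists M => m /HM /= me; apply: eV; split => /=; first exact: ballxx.
rewrite /ball /= sub0r normrN ger0_norm ?ltW ?arens_height_gt0//.
apply: le_lt_trans me; rewrite lef_pV2 ?posrE ?ltr0n ?muln_gt0// ler_nat.
by rewrite leq_pmull.
Qed.

(** Leaves are isolated in their arm by horizontal strips, so openness is a condition at the node
    only, whose neighborhoods in the arm are cut out by half-planes below a leaf. *)
Lemma arens_open_trace n (S : set nat) (W : set (R * R)) :
  (forall m, W (arens_leaf n m) <-> S m) ->
  (W (n.+1%:R^-1, 0) -> exists M, forall m, (M <= m)%N -> S m) ->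
  open (W : set (subspace (@arens_seq R n.+1))).
Proof.
move=> WS Wn; apply/open_subspaceP.
have /choice[V HV] m := arens_leaf_isolated n m.
pose V0 := \bigcup_(m in S) V m.
have oV0 : open V0 by apply: bigcup_open => m _; have [] := HV m.
have V0m m : S m -> V0 (arens_leaf n m).
  by move=> Sm; exists m => //; have [] := HV m.
have V0W p : @arens_seq R n.+1 p -> V0 p -> W p.
  by move=> np [m Sm Vp]; have [_ _ /(_ p np Vp) ->] := HV m; exact/WS.
case: (pselect (W (n.+1%:R^-1, 0))) => [/[dup] W0 /Wn[M HM]|nW].
  exists (V0 `|` [set p | p.2 < arens_height n M]).
    by apply: openU => //; exact: open_height_lt.
  apply/seteqP; split => p [].
    move=> [Vp np|/= pM np]; split => //; first exact: V0W.
    move/arens_seqSP: np pM => [->//|[m ->]] /=.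
    by rewrite ltr_arens_height => Mm; apply/WS/HM/ltnW.
  move=> Wp np; split => //; move/arens_seqSP: np Wp => [-> _|[m ->] /WS Sm].
    by right => /=; exact: arens_height_gt0.
  by left; exact: V0m.
exists V0 => //; apply/seteqP; split => p [Vp np]; split => //.
  exact: V0W.
by move/arens_seqSP: np Vp => [->//|[m ->] /WS]; exact: V0m.
Qed.

End ArensPoints.

Section FanCopy.
Variable R : realType.
Variable G : topologicalGroupType.
Local Open Scope group_scope.
Local Open Scope quotient_scope.
Implicit Types (z : G) (A U : set G).
Hypothesis T1G : accessible_space G.
Hypothesis seqG : sequential_space G.
Variable x : nat -> nat -> G.
Hypothesis fanx : is_fan x.
Hypothesis x_neq1 : forall n m, x n m <> 1.
Hypothesis x_inj : forall n m n' m', x n m = x n' m' -> n = n' /\ m = m'.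

(** A sequence of [A] with infinitely many positions in one arm can only tend to [1], which has been
    added. *)
Lemma fan_set1_closed A : A `<=` [set x n m | n in setT & m in setT] ->
  closed (1 |` A).
Proof.
move=> Ax; apply: sequential_closed => // z u uA uz.
case: (pselect (z = 1)) => [->|z1]; [by left|right].
have [L HL] := cvg_seq_neq T1G z1 uz.
have ai : strictly_increasing (addn L) by move=> k; rewrite ltn_add2l.
have {}uz := cvg_subsequence ai uz.
have {}uA k : A (u (L + k)%N) 
  by have [e|//] := uA (L + k)%N; exfalso; exact: HL (leq_addr _ _) e.
have /choice[n /choice[m xu]] k : exists n m, x n m = u (L + k)%N.
  by have [n _ [m _ <-]] := Ax _ (uA k); exists n, m.
have [c [p [pi np]]] : exists c p, strictly_increasing p /\ forall k, n (p k) = c.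
  apply: (@fan_sequence_bounded _ x fanx n m z).
  by apply: (cvg_seq_eventually (N := 0) _ uz) => k _ /=.
have {}uz := cvg_subsequence pi uz.
case: (nat_subsequence (m \o p)) => [[e [q qi mq]]|[q qi mi]]; last first.
  exfalso; apply: z1; apply: (cvg_seq_unique T1G (cvg_subsequence qi uz)).
  apply: (cvg_seq_eventually (N := 0) _ (cvg_subsequence mi (fanx.1 c))) => k _ /=.
  by rewrite -(np (q k)) xu.
rewrite (_ : z = u (L + p (q 0))%N) //.
have uq : (fun _ : nat => u (L + p (q 0))%N) @ \oo --> z.
  apply: (cvg_seq_eventually (N := 0) _ (cvg_subsequence qi uz)) => k _ /=.
  by rewrite -!xu !np; move: (mq k) (mq 0) => /= -> ->.
exact: (cvg_seq_unique T1G uq (@cvg_seq_cst _ _)).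
Qed.

Let E : set G := 1 |` [set x n m | n in setT & m in setT].

Let leaf n m : arens_space R := exist _ (arens_leaf R n m) (arens_leaf_set R n m).

Let root_set : ((0, 0)%R : R * R) \in @arens_set R.
Proof. by rewrite inE; exists 0 => //; left. Qed.

Let root : arens_space R := exist (fun p => p \in @arens_set R) (0, 0)%R root_set.

Let arens_cases (p : arens_space R) :
  @arens_seq R 0 (set_val p) \/ exists n m, p = leaf n m.
Proof.
have [|[n [m pnm]]] := arens_setP (set_valP p); first by left.
by right; exists n, m; apply: val_inj.
Qed.

(** The default [root] serves as the value at [1]. *)
Let leaf_of z : arens_space R :=
  if pselect (exists p, z = x p.1 p.2) is left e
  then leaf (projT1 (cid e)).1 (projT1 (cid e)).2 else root.

Let leaf_ofE n m : leaf_of (x n m) = leaf n m.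
Proof.
rewrite /leaf_of; case: pselect => [e|[]]; last by exists (n, m).
by case: cid => -[n' m'] /= /x_inj[-> ->].
Qed.

Let leaf_of1 : leaf_of 1 = root.
Proof.
rewrite /leaf_of; case: pselect => // e; exfalso.
by have [p /esym/x_neq1] := e.
Qed.

(** The default [1] is the value on all of [C_0], which the fan collapses. *)
Let point_of (p : arens_space R) : G :=
  if pselect (exists q, p = leaf q.1 q.2) is left e
  then x (projT1 (cid e)).1 (projT1 (cid e)).2 else 1.

Let point_ofE n m : point_of (leaf n m) = x n m.
Proof.
rewrite /point_of; case: pselect => [e|[]]; last by exists (n, m).
by case: cid => -[n' m'] /= e'; have [-> ->] := arens_leaf_inj (congr1 set_val e').
Qed.

Let point_of1 p : @arens_seq R 0 (set_val p) -> point_of p = 1.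
Proof.
move=> p0; rewrite /point_of; case: pselect => // e; exfalso.
have [q pq] := e; by move: p0; rewrite pq => /arens_leaf_not_root.
Qed.

Let point_of_E p : point_of p \in E.
Proof.
rewrite inE; have [p0|[n [m ->]]] := arens_cases p.
  by left; exact: point_of1.
by right; rewrite point_ofE; exists n => //; exists m.
Qed.

Let point_of_fan p q : fan_rel p q -> point_of p = point_of q.
Proof.
rewrite /fan_rel => /orP[/eqP->//|/andP[]]; rewrite !inE => p0 q0.
by rewrite !point_of1.
Qed.

Let leaf_of_fan p : fan_rel (leaf_of (point_of p)) p.
Proof.
have [p0|[n [m ->]]] := arens_cases p; last first.
  by rewrite point_ofE leaf_ofE /fan_rel eqxx.
rewrite point_of1// leaf_of1 /fan_rel; apply/orP; right.
by apply/andP; split; rewrite inE //=; left.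
Qed.

Let continuous_point_of : continuous point_of.
Proof.
apply/continuousP => U oU; suff : arens_open (point_of @^-1` U) by [].
case=> [|n].
  have root1 (p : R * R) : @arens_seq R 0 p ->
      (set_val @` (point_of @^-1` U)) p <-> U 1.
    move=> p0; have pA : p \in @arens_set R by rewrite inE; exists 0.
    split => [[q /= Uq qp]|U1]; first by rewrite -(point_of1 (p := q)) ?qp.
    by exists (exist (fun p => p \in @arens_set R) p pA) => //=; rewrite point_of1.
  apply/open_subspaceP; case: (pselect (U 1)) => U1.
    exists setT; first exact: openT.
    by apply/seteqP; split => p [? p0]; split => //; exact/root1.
  exists set0; first exact: open0.
  by apply/seteqP; split => p [+ p0] => // /(root1 _ p0).
have node p (q : R * R) : set_val p = q -> (set_val @` (point_of @^-1` U)) q <->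
    U (point_of p).
  move=> <-; split; first by move=> [p' /= Up /val_inj <-].
  by move=> Up; exists p.
apply: (@arens_open_trace R n [set m | U (x n m)]) => [m|[p /= Up pn]].
  by rewrite (@node (leaf n m))// point_ofE.
have U1 : U 1.
  rewrite -(point_of1 (p := p)) ?pn //; exact: arens_node_root.
have /cvg_seqP/(_ U (open_nbhs_nbhs (conj oU U1)))[M HM] := fanx.1 n.
by exists M.
Qed.

Let Q := sequential_fan R.

Let to_fan (e : E) : Q := \pi_Q (leaf_of (set_val e)).

Let of_fan (q : Q) : E :=
  exist (fun z => z \in E) (point_of (repr q)) (point_of_E _).

Let pi_fan p q : fan_rel p q -> \pi_Q p = \pi_Q q.
Proof. by move=> pq; apply/eqquotP. Qed.

Let of_fan_pi p : set_val (of_fan (\pi_Q p)) = point_of p.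
Proof.
apply: point_of_fan.
have /eqquotP : (repr (\pi_Q p) = p %[mod {eq_quot (fan_equiv R)}]) := reprK (\pi_Q p).
by [].
Qed.

Let E_cases (e : E) : set_val e = 1 \/ exists n m, set_val e = x n m.
Proof.
by have [e1|[n _ [m _ xe]]] := set_valP e; [left|right; exists n, m].
Qed.

Let of_fanK : cancel of_fan to_fan.
Proof.
move=> q; rewrite -[q]reprK /to_fan of_fan_pi; apply: pi_fan.
exact: leaf_of_fan.
Qed.

Let to_fanK : cancel to_fan of_fan.
Proof.
move=> e; apply: val_inj; rewrite [LHS]of_fan_pi.
have [e1|[n [m enm]]] := E_cases e; last by rewrite enm leaf_ofE point_ofE.
by rewrite e1 leaf_of1 point_of1//=; left.
Qed.

Let continuous_of_fan : continuous of_fan.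
Proof.
apply/quotient_continuous/continuousP => _ [U oU <-].
move/continuousP: continuous_point_of => /(_ U oU).
congr open; apply/seteqP; split => p /=; by rewrite of_fan_pi.
Qed.

Let continuous_to_fan : continuous to_fan.
Proof.
apply/continuousP => O oO'.
have oO : arens_open (\pi_Q @^-1` O) := oO'.
(* [A False] consists of the fan points mapped outside [O]. If [O] contains the root, it is finite
   in each arm and closed; otherwise it is closed after adding [1]. *)
pose A (P : Prop) := [set z | exists n m, z = x n m /\ (O (\pi_Q (leaf n m)) <-> P)].
have Ax P : A P `<=` [set x n m | n in setT & m in setT].
  by move=> _ [n [m [-> _]]]; exists n => //; exists m.
case: (pselect (O (\pi_Q root))) => [Oroot|nOroot].
  exists (~` A False).
    apply: closed_openC; apply: (fan_finite_arms_closed T1G seqG fanx (Ax _)) => n.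
    have /open_subspaceP[V oV VO] := oO n.+1.
    have [|M HM] := arens_leaf_cvg oV (n := n).
      have nodeA : ((n.+1%:R^-1, 0)%R : R * R) \in @arens_set R.
        by rewrite inE; exists 0 => //; exact: arens_node_root.
      pose node : arens_space R := exist (fun p => p \in @arens_set R) _ nodeA.
      suff [] : (V `&` @arens_seq R n.+1) (n.+1%:R^-1, 0)%R by [].
      rewrite VO; split; last by apply/arens_seqSP; left.
      exists node => //; rewrite /preimage /= (_ : \pi_Q node = \pi_Q root) //.
      apply: pi_fan; apply/orP; right; apply/andP; split; apply/mem_set.
        exact: arens_node_root.
      by left.
    exists M => m Mm [n' [m' [/x_inj[<- <-] [+ _]]]]; apply.
    have : (V `&` @arens_seq R n.+1) (arens_leaf R n m).
      by split; [exact: HM|exact: arens_leaf_seq].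
    rewrite VO => -[[p Op pl] _]; rewrite (_ : leaf n m = p) //.
    exact/esym/val_inj.
  apply/seteqP; split => e /=; have [e1|[n [m enm]]] := E_cases e.
  - by rewrite /to_fan e1 leaf_of1.
  - rewrite /to_fan enm leaf_ofE => nA; apply: contrapT => nO; apply: nA.
    by exists n, m.
  - by rewrite e1 => _ [n [m [/esym/x_neq1]]].
  rewrite /to_fan enm leaf_ofE => Oe [n' [m' [/x_inj[<- <-] [+ _]]]].
  exact.
exists (~` (1 |` A False)).
  by apply: closed_openC; exact: fan_set1_closed.
apply/seteqP; split => e /=; have [e1|[n [m enm]]] := E_cases e.
- by move=> []; left.
- rewrite /to_fan enm leaf_ofE => nA; apply: contrapT => nO; apply: nA; right.
  by exists n, m.
- by rewrite /to_fan e1 leaf_of1.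
rewrite /to_fan enm leaf_ofE => Oe [/x_neq1//|[n' [m' [/x_inj[<- <-] [+ _]]]]].
exact.
Qed.

Lemma fan_contains_closed_copy : contains_closed_copy G (sequential_fan R).
Proof.
exists E; first exact: fan_set1_closed.
by exists to_fan, of_fan; split.
Qed.

End FanCopy.

(** * Least cardinals *)

(** Zorn's lemma on families of choice functions that differ pairwise at every member of [P]. In a
    maximal family the values at some [A] exhaust [A], as otherwise a function with new values could
    be added; sending [g A] to [g B] then embeds [A] in [B]. *)
Lemma card_le_minimum T (P : set T -> Prop) (A0 : set T) : P A0 ->
  exists2 A : set T, P A & forall B : set T, P B -> A #<= B.
Proof.
move=> PA0.
pose F (S : set (set T -> T)) := (forall g, S g -> forall A, P A -> A (g A)) /\
  (forall g h, S g -> S h -> forall A, P A -> g A = h A -> g = h).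
have [S [[SA Sinj] Smax]] : exists S, F S /\ forall S', S `<` S' -> ~ F S'.
  apply: Zorn_bigcup => Y YF Ytot; split.
    by move=> g [S YS Sg]; exact: (YF S YS).1.
  move=> g h [S YS Sg] [S' YS' Sh] A PA.
  have [SS|SS] := Ytot _ _ YS YS'.
    by apply: (YF S' YS').2 => //; exact: SS.
  by apply: (YF S YS).2 => //; exact: SS.
have [A PA AS] : exists2 A, P A & A `<=` (fun g => g A) @` S.
  apply: contrapT => H.
  have /choice[g Hg] (A : set T) : exists t, P A -> A t /\ ~ ((fun g => g A) @` S) t.
    case: (pselect (P A)) => [PA|nPA].
      have /existsNP[t /not_implyP[At nt]] : ~ (A `<=` (fun g => g A) @` S).
        by move=> AS; apply: H; exists A.
      by exists t.
    have [[t _]|nt] := pselect (exists t : T, True); first by exists t.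
    exfalso; apply: H; exists A0 => // t; by exfalso; apply: nt; exists t.
  apply: (Smax (S `|` [set g])).
    split=> [h Sh|gS]; first by left.
    by apply: (Hg A0 PA0).2; exists g => //; apply: gS; right.
  split=> [h [Sh|->] A PA|h k Sh Sk A PA hk].
    exact: (SA h Sh A PA).
    exact: (Hg A PA).1.
  move: Sh Sk hk => [Sh|->] [Sk|->] hk //; first exact: (Sinj h k Sh Sk A PA hk).
    by exfalso; apply: (Hg A PA).2; exists h.
  by exfalso; apply: (Hg A PA).2; exists k.
exists A => // B PB; apply: card_le_trans (subset_card_le AS) _.
apply: card_le_trans (card_image_le _ _) _.
apply: (injection_card_le (f := fun g => g B)) => [g Sg|g h Sg Sh gh].
  exact: (SA g Sg B PB).
exact: (Sinj g h Sg Sh B PB gh).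
Qed.

(** A supremum of least sizes bounds anything at a point only once a least size there is known to
    exist. *)
Lemma least_size_exists T (P : set T -> Prop) (A0 : set T) : P A0 ->
  exists2 A : set T, P A & least_size P A.
Proof.
move=> /card_le_minimum[A PA minA]; exists A => //; split.
  by exists A => //; rewrite card_eq_sym card_setT.
move=> L [B PB BL]; rewrite (card_le_eql (card_setT A)) -(card_le_eqr BL).
exact: minA.
Qed.

(** By regularity the members can be replaced by their closures. Closedness is what yields, in a set
    that is not sequentially compact, a sequence with no subsequence converging anywhere in the
    group. *)
Lemma countable_cs_star_unit_network (G : topologicalGroupType) :
  accessible_space G -> countable_cs_star_character G ->
  exists N : nat -> set G, unit_network N /\ forall i, closed (N i).
Proof.
move=> T1G [K [csK _] cK].
have [NN csNN leastNN] : exists2 NN, cs_star_network (1%g : G) NN &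
    least_size (cs_star_network (1%g : G)) NN.
  apply: (@least_size_exists _ _ setT) => U u nU u1; exists U; split => //.
  move/cvg_seqP: u1 => /(_ U nU)[M HM] fU; apply: infinite_nat.
  apply: (@sub_finite_set _ _ (`I_M `|` [set n | U (u n)])).
    by move=> n _; case: (ltnP n M) => [nM|/HM]; [left|right].
  by rewrite finite_setU; split => //; exact: finite_II.
have /countable_injP[q qi] : countable NN.
  apply: sub_countable cK; rewrite -(card_le_eql (card_setT NN)).
  exact: csK leastNN.
pose N n := [set z | exists2 B, NN B & q B = n /\ closure B z].
have NE B : NN B -> N (q B) = closure B.
  move=> NB; apply/seteqP; split => z; last by exists B.
  move=> [B' NB' [qB Bz]].
  by rewrite -(qi _ _ (mem_set NB') (mem_set NB) qB).
exists N; split => [U u /nbhs_unit_closure[V nV VU] u1|i].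
  have [B [NB BV /infinite_set_nat iB]] := csNN V u nV u1.
  exists (q B); rewrite NE //.
    by apply: subset_trans VU; exact: closureS.
  by move=> m; have [n mn Bn] := iB m; exists n => //; exact: subset_closure.
case: (pselect (exists2 B, NN B & q B = i)) => [[B NB <-]|nB].
  by rewrite NE //; exact: closed_closure.
rewrite (_ : N i = set0); first exact: closed0.
by rewrite -subset0 => z [B NB [qB _]]; apply: nB; exists B.
Qed.

Theorem theorem3 (R : realType) (G : topologicalGroupType)
  (T1G : accessible_space G)
  (seqG : sequential_space G)
  (csG : countable_cs_star_character G)
  (condG :
      (exists2 a, is_seq_order G a & olt a omega1)
   \/ invariant_lt (sb_character G) dominating_number
   \/ invariant_lt (boundedness_index G) (k_ness G)
   \/ frechet_urysohn G
   \/ alpha7_space G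
   \/ (~ contains_closed_copy G (sequential_fan R) /\
       ~ contains_closed_copy G (arens_space R))
   \/ ~ weil_complete G
   \/ baire_space G
   \/ (exists2 K, boundedness_index G K &
         card_lt [set: K] [set: G] /\ card_lt [set: G] [set: set nat])) :
  metrizable G R.
Proof.
have [N [netN closedN]] := countable_cs_star_unit_network T1G csG.
apply: contrapT => nmG; have [x0 fanx0] := nonmetrizable_fan T1G seqG netN nmG.
have [x [fanx x_neq1 x_inj]] := injective_fan T1G fanx0.
have [K [cK KG]] := sequentially_compact_cover T1G seqG fanx netN closedN.
have [C kC] := sequentially_compact_cover_k_omega cK KG.
have compactC n : compact (C n).
  by case: kC => sC _ _ _ _; exact: sequentially_compact_compact T1G seqG _ netN _ (sC n).
case: condG => [so|[[K0 [L [sbK dL [KL]]]]|[[K0 [L [ibK kL [_]]]]|]]].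
- exact: (fan_seq_order T1G seqG kC fanx x_inj so).
- apply; have [NN sbNN leastNN] : exists2 NN, sb_network (1%g : G) NN &
      least_size (sb_network (1%g : G)) NN.
    apply: (@least_size_exists _ _ (nbhs (1%g : G))); split => [U nU u u1|U nU].
      exact: u1.
    by exists U; split => //; exact: nbhs_singleton.
  have [D DNN domD] := fan_sb_network_dominating T1G seqG fanx x_neq1 x_inj sbNN.
  apply: (card_le_trans (dL.2 D _)).
    by exists D => //; rewrite card_eq_sym card_setT.
  rewrite (card_le_eql (card_setT D)); apply: card_le_trans DNN _.
  by rewrite -(card_le_eql (card_setT NN)); exact: sbK.1 leastNN.
- by apply; exact: (k_ness_le_boundedness T1G seqG kC compactC fanx ibK kL).
case=> [FU|[a7|[[nofan _]|[nW|[bG|[K0 ibK [[_ nGK] [_ n2G]]]]]]]].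
- exact: (fan_not_frechet_urysohn T1G fanx x_neq1 FU).
- exact: (fan_not_alpha7 fanx x_inj a7).
- by apply: nofan; exact: fan_contains_closed_copy x_inj.
- by apply: nW; exact: k_omega_weil_complete kC compactC.
- exact: (fan_not_baire T1G seqG fanx kC bG).
apply: nGK; apply: (countable_core_card_le T1G seqG kC fanx ibK).
(* The core is countable, since an uncountable [C n] would give [G] at least as many points as there
   are sets of naturals. *)
rewrite (_ : k_core C = \bigcup_(n in setT) C n); last first.
  by apply/seteqP; split => z [n] => [Cz|_ Cz]; exists n.
apply: bigcup_countable => // n _; apply: contrapT => uC; apply: n2G.
case: kC => sC _ _ _ _.
exact: (uncountable_compact_card T1G seqG netN (sC n) uC).
Qed.
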